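(* Let $k\in\{4,5,6,\dots\}\cup\{\infty\}$, and for a positive integer $t$ let $R^{(k)}_{2t}$ be the set of reciprocal geodesics $\gamma$ based at the order $2$ cone point of the $(2,k,\infty)$ Hecke surface $X_k$ with $|\gamma|=2t$ (equivalently, the set of conjugacy classes of length $2t$ in $\mathbb{Z}_2*\mathbb{Z}_k$ of products of two distinct conjugates of $a$). Then: (1) For $k=2m+1$ with $m\ge 2$, $$\frac{|R^{(2m+1)}_{2t}|}{\alpha_{2m+1}^{t}}\xrightarrow{t\to\infty}\frac{c_{2m+1}}{2},$$ where $c_{2m+1}$ is a positive constant and $\alpha_{2m+1}$ is the unique positive root of the polynomial $x^{m+1}-2x^{m-1}-2x^{m-2}-\dots-2x-2$. (2) For $k=2m$ with $m\ge 2$, $$\frac{|R^{(2m)}_{2t}|}{\beta_{2m}^{t}}\xrightarrow{t\to\infty}\frac{d_{2m}}{2},$$ where $d_{2m}$ is a positive constant and $\beta_{2m}$ is the unique positive root of the polynomial $x^{m+1}-2x^{m-1}-2x^{m-2}-\dots-2x-1$. (3) For $k=\infty$, $$\frac{|R^{(\infty)}_{2t}|}{2^{t}}\xrightarrow{t\to\infty}\frac16 .$$ Moreover, in each of (1)-(3) the same asymptotics (same exponential base and same limit) hold when $R^{(k)}_{2t}$ is replaced by its subset of primitive reciprocal geodesics. The constants $c_{2m+1}$ and $d_{2m}$ are the specific coefficients defined in the context.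
   Context: Let $G=\mathbb{Z}_2*\mathbb{Z}_k$, $3\le k\le\infty$ (for $k=\infty$, $G=\mathbb{Z}_2*\mathbb{Z}$), with $a$ the generator of $\mathbb{Z}_2$ and $b$ the generator of $\mathbb{Z}_k$ (resp. $\mathbb{Z}$). The Hecke group $\Gamma_k\subset \mathrm{PSL}(2,\mathbb{R})$ is the image of $G$ under the discrete faithful representation $a\mapsto A=\begin{pmatrix}0&-1\\1&0\end{pmatrix}$, $b\mapsto B=\begin{pmatrix}0&-1\\1&2\cos(\pi/k)\end{pmatrix}$ (with lower right entry $2$ if $k=\infty$), and $X_k=\mathbb{H}/\Gamma_k$ is the $(2,k,\infty)$ Hecke surface. Its order $2$ cone point is the projection of the fixed point of $A$. A reciprocal geodesic based at the order $2$ cone point is (i.e. corresponds to) the conjugacy class in $G\cong\Gamma_k$ of an element that is a product of two distinct involutions, both conjugate to $a$; such an element is automatically hyperbolic. Geodesics are counted as conjugacy classes. The word length $|g|$ of $g\in G$ is with respect to $\{a,b,b^{-1}\}$. The length $|\gamma|$ of a reciprocal geodesic $\gamma$ corresponding to a conjugacy class $[g]$ is $|[g]|=\min\{|h|: h\in[g]\}$. An element $g\in G$ is primitive if it is not a non-trivial power of another element of $G$; a reciprocal geodesic is primitive if the elements of its conjugacy class are primitive. Constants. For finite $k$ let $E_k=\{l\in\mathbb{Z}\setminus\{0\}: -\lfloor\frac{k-1}{2}\rfloor\le l\le\lfloor\frac k2\rfloor\}$. A $(bb)$-word is an element $b^{x_0}ab^{x_1}\cdots ab^{x_{n-1}}$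 with $n\ge1$ and all $x_i\in E_k$. Let $\mathcal{N}_{2t}$ be the set of elements $[a,h]=aha^{-1}h^{-1}$, $h$ a $(bb)$-word, with $|[a,h]|=2t$ (word length). For finite $k\geq 4$, the sequence $|\mathcal{N}_{2t}|$, $t\ge2$, satisfies a linear recurrence with constant coefficients whose characteristic polynomial is the polynomial displayed in (1) (if $k=2m+1$) or (2) (if $k=2m$). This polynomial has $m+1$ distinct complex roots $\lambda_0,\dots,\lambda_m$, where $\lambda_0$ is the unique positive root. Thus there are unique constants $a_0,\dots,a_m$ with $|\mathcal{N}_{2t}|=\sum_{i=0}^m a_i\lambda_i^t$ for all $t\ge 2$. The constant $c_{2m+1}$ (for $k=2m+1$), respectively $d_{2m}$ (for $k=2m$), is the coefficient $a_0$ of the positive root. *)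

(* Defs.v *)
From HB Require Import structures.
From mathcomp Require Import all_boot all_order all_algebra.
From mathcomp Require Import all_classical all_reals all_analysis.
From mathcomp Require Import finmap.
From mathcomp Require Export complex.

Set Implicit Arguments.
Unset Strict Implicit.
Unset Printing Implicit Defensive.

Import Order.TTheory GRing.Theory Num.Theory.
Import numFieldNormedType.Exports.

Local Open Scope classical_set_scope.

(** The group Z_2 * Z_k, as the monoid of words in a, b, b^-1 modulo the
    congruence generated by the relations below. The parameter [k : option nat]
    is [Some k] for Z_2 * Z_k and [None] for Z_2 * Z, i.e. k = oo. *)

Inductive letter := La | Lb | LbV.

Definition code_letter (l : letter) : option bool :=
  match l with La => None | Lb => Some true | LbV => Some false end.
Definition decode_letter (o : option bool) : letter :=
  match o with None => La | Some true => Lb | Some false => LbV end.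
Lemma code_letterK : cancel code_letter decode_letter. Proof. by case. Qed.
HB.instance Definition _ := Countable.copy letter (can_type code_letterK).

Definition flip_letter (l : letter) : letter :=
  match l with La => La | Lb => LbV | LbV => Lb end.
Definition flip_word (w : seq letter) : seq letter := rev (map flip_letter w).

Inductive word_eq (k : option nat) : seq letter -> seq letter -> Prop :=
| word_eq_refl w : word_eq k w w
| word_eq_sym v w : word_eq k v w -> word_eq k w v
| word_eq_trans u v w : word_eq k u v -> word_eq k v w -> word_eq k u w
| word_eq_cat v v' w w' :
    word_eq k v v' -> word_eq k w w' -> word_eq k (v ++ w) (v' ++ w')
| word_eq_aa : word_eq k [:: La; La] [::]
| word_eq_bbV : word_eq k [:: Lb; LbV] [::]
| word_eq_bVb : word_eq k [:: LbV; Lb] [::]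
| word_eq_bk n : k = Some n -> word_eq k (nseq n Lb) [::].

Section Z2_free_product.
Variable k : option nat.

Definition word_eqb (v w : seq letter) : bool := `[< word_eq k v w >].

Lemma word_eqb_refl : reflexive word_eqb.
Proof. by move=> w; apply/asboolP; apply: word_eq_refl. Qed.
Lemma word_eqb_sym : symmetric word_eqb.
Proof. by move=> v w; apply/asboolP/asboolP; apply: word_eq_sym. Qed.
Lemma word_eqb_trans : transitive word_eqb.
Proof.
by move=> v u w /asboolP uv /asboolP vw; apply/asboolP; apply: word_eq_trans vw.
Qed.

Canonical word_equiv := EquivRel word_eqb word_eqb_refl word_eqb_sym word_eqb_trans.

Definition Z2free : Type := {eq_quot word_equiv}%qT.
HB.instance Definition _ := Choice.on Z2free.
HB.instance Definition _ := EqQuotient.on Z2free.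

Definition of_word (w : seq letter) : Z2free := (\pi_Z2free w)%qT.
Definition to_word (g : Z2free) : seq letter := repr g.

Lemma to_wordK : cancel to_word of_word.
Proof. exact: reprK. Qed.

Lemma of_wordP v w : of_word v = of_word w <-> word_eq k v w.
Proof. by split=> [/eqmodP/asboolP//|vw]; apply/eqmodP/asboolP. Qed.

Lemma of_word_repr w : word_eq k (to_word (of_word w)) w.
Proof. by apply/of_wordP; rewrite to_wordK. Qed.

Lemma word_eq_flip v w : word_eq k v w -> word_eq k (flip_word v) (flip_word w).
Proof.
have flip_bk n : flip_word (nseq n Lb) = nseq n LbV.
  by rewrite /flip_word map_nseq rev_nseq.
have bkVbk n : word_eq k (nseq n LbV ++ nseq n Lb) [::].
  elim: n => [|n IHn]; first exact: word_eq_refl.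
  have -> : nseq n.+1 LbV ++ nseq n.+1 Lb =
            (nseq n LbV ++ [:: LbV; Lb]) ++ nseq n Lb.
    by rewrite -addn1 nseqD addn1 -!catA.
  apply: word_eq_trans IHn; apply: word_eq_cat (word_eq_refl _ _).
  rewrite -[in X in word_eq k _ X](cats0 (nseq n LbV)).
  exact: word_eq_cat (word_eq_refl _ _) (word_eq_bVb _).
elim=> {v w} [w|v w _|u v w _ uv _|v v' w w' _ vv' _ ww'||||n kn].
- exact: word_eq_refl.
- exact: word_eq_sym.
- exact: word_eq_trans.
- by rewrite /flip_word !map_cat !rev_cat; apply: word_eq_cat.
- exact: word_eq_aa.
- exact: word_eq_bbV.
- exact: word_eq_bVb.
- rewrite flip_bk; apply: word_eq_trans (bkVbk n).
  rewrite -[X in word_eq k X _]cats0.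
  apply: word_eq_cat (word_eq_refl _ _) _.
  exact/word_eq_sym/word_eq_bk.
Qed.

Definition Z2free_mul (g h : Z2free) : Z2free := of_word (to_word g ++ to_word h).
Definition Z2free_inv (g : Z2free) : Z2free := of_word (flip_word (to_word g)).

Lemma of_word_cat v w : Z2free_mul (of_word v) (of_word w) = of_word (v ++ w).
Proof. by apply/of_wordP; apply: word_eq_cat; apply: of_word_repr. Qed.

Lemma Z2free_mulA : associative Z2free_mul.
Proof.
move=> x y z; rewrite -(to_wordK x) -(to_wordK y) -(to_wordK z).
by rewrite !of_word_cat catA.
Qed.
Lemma Z2free_mul1 : left_id (of_word [::]) Z2free_mul.
Proof. by move=> x; rewrite -(to_wordK x) of_word_cat. Qed.
Lemma Z2free_mulr1 : right_id (of_word [::]) Z2free_mul.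
Proof. by move=> x; rewrite -(to_wordK x) of_word_cat cats0. Qed.

Lemma flip_wordK : involutive flip_word.
Proof.
by move=> w; rewrite /flip_word map_rev revK -map_comp map_id_in // => -[].
Qed.

Lemma flip_word_cancel w : word_eq k (flip_word w ++ w) [::].
Proof.
elim: w => [|l w IHw]; first exact: word_eq_refl.
have -> : flip_word (l :: w) ++ l :: w =
          (flip_word w ++ [:: flip_letter l; l]) ++ w.
  by rewrite /flip_word /= rev_cons -cats1 -!catA.
apply: word_eq_trans IHw; apply: word_eq_cat (word_eq_refl _ _).
rewrite -[in X in word_eq k _ X](cats0 (flip_word w)).
apply: word_eq_cat (word_eq_refl _ _) _.
by case: l; [exact: word_eq_aa|exact: word_eq_bVb|exact: word_eq_bbV].
Qed.

Lemma Z2free_mulV : left_inverse (of_word [::]) Z2free_inv Z2free_mul.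
Proof.
move=> x; rewrite /Z2free_inv -[x in Z2free_mul _ x]to_wordK of_word_cat.
exact/of_wordP/flip_word_cancel.
Qed.
Lemma Z2free_mulrV : right_inverse (of_word [::]) Z2free_inv Z2free_mul.
Proof.
move=> x; rewrite /Z2free_inv -[x in Z2free_mul x _]to_wordK of_word_cat.
by apply/of_wordP; rewrite -{1}(flip_wordK (to_word x)); apply: flip_word_cancel.
Qed.

HB.instance Definition _ := isGroup.Build Z2free
  Z2free_mulA Z2free_mul1 Z2free_mulr1 Z2free_mulV Z2free_mulrV.

Definition ga : Z2free := of_word [:: La].
Definition gb : Z2free := of_word [:: Lb].

End Z2_free_product.

Arguments ga {k}.
Arguments gb {k}.

(** Generic notions *)

(* Meant for nonempty A only; the value at the empty set is junk. *)
Definition min_nat (A : set nat) : nat :=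
  xget 0%N [set n | A n /\ forall m, A m -> (n <= m)%N].

(* Meant for finite A only; all the sets counted below are finite, because
   they consist of elements of a ball of a finitely generated group, or of
   conjugacy classes meeting such a ball. *)
Definition card_set (T : choiceType) (A : set T) : nat := #|` fset_set A |.

Definition conj_class (G : groupType) (g : G) : set G :=
  [set x | exists y, x = (g ^ y)%g].

Definition primitive_elt (G : groupType) (g : G) : Prop :=
  ~ exists h n, [/\ h <> g, (2 <= n)%N & g = (h ^+ n)%g].

Definition expgz (G : groupType) (g : G) (n : int) : G :=
  match n with Posz n => (g ^+ n)%g | Negz n => (g ^- n.+1)%g end.

(** Lengths and reciprocal geodesics *)

Definition word_length k (g : Z2free k) : nat :=
  min_nat [set size w | w in [set w : seq (Z2free k) |
    {subset w <= [:: ga; gb; gb^-1]}%g /\ g = (\prod_(s <- w) s)%g]].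

Definition class_length k (C : set (Z2free k)) : nat :=
  min_nat [set word_length h | h in C].

Definition reciprocal_geodesic k (C : set (Z2free k)) : Prop :=
  exists i j, [/\ conj_class ga i, conj_class ga j, i <> j
                & C = conj_class (i * j)%g].

Definition reciprocal_set k (n : nat) : set (set (Z2free k)) :=
  [set C | reciprocal_geodesic C /\ class_length C = n].

Arguments reciprocal_set : clear implicits.

Definition primitive_reciprocal_set k (n : nat) : set (set (Z2free k)) :=
  [set C | reciprocal_set k n C /\ forall g, C g -> primitive_elt g].

Arguments primitive_reciprocal_set : clear implicits.

(** The constants, for finite k *)

Definition in_E (k : nat) (l : int) : bool :=
  [&& l != 0, - (k.-1)./2%:Z <= l & l <= (k./2)%:Z]%R.

Fixpoint bb_elt (k : option nat) (x : int) (xs : seq int) : Z2free k :=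
  match xs with
  | [::] => expgz gb x
  | y :: ys => (expgz gb x * ga * bb_elt k y ys)%g
  end.

Definition bb_word (k : nat) (h : Z2free (Some k)) : Prop :=
  exists x xs, all (in_E k) (x :: xs) /\ h = bb_elt (Some k) x xs.

(* The commutator convention is [a,h] = a h a^-1 h^-1, which is not that of the
   library's [~ a, h]. *)
Definition N_set (k n : nat) : set (Z2free (Some k)) :=
  [set g | exists h, [/\ bb_word h, g = (ga * h * ga^-1 * h^-1)%g
                       & word_length g = n]].
Arguments N_set : clear implicits.

Local Open Scope ring_scope.

Definition hecke_poly_odd (R : nzRingType) (m : nat) : {poly R} :=
  'X^(m.+1) - \sum_(0 <= j < m) 2%:R *: 'X^j.

Definition hecke_poly_even (R : nzRingType) (m : nat) : {poly R} :=
  'X^(m.+1) - \sum_(1 <= j < m) 2%:R *: 'X^j - 1.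

Definition unique_pos_root (R : realType) (p : {poly R}) (x : R) : Prop :=
  [/\ 0 < x, root p x & forall y, 0 < y -> root p y -> y = x].

(* p of degree m+1 has m+1 distinct complex roots lam i, with lam 0 = x, and
   c is the coefficient of x^t in u t = \sum_i coef i * lam i ^ t (t >= 2). The
   polynomials used here have nonzero constant term, so the lam i are nonzero,
   the coefficients are determined by u and lam, and c by u, p and x. *)
Definition root_coefficient (R : realType) (m : nat) (p : {poly R})
    (u : nat -> nat) (x c : R) : Prop :=
  exists lam coef : 'I_m.+1 -> R[i],
    [/\ injective lam,
        forall i, root (map_poly (real_complex R) p) (lam i),
        lam ord0 = x%:C%C,
        coef ord0 = c%:C%C &
        forall t, (2 <= t)%N ->
          (u t)%:R = \sum_(i < m.+1) coef i * lam i ^+ t].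

Definition growth_limit (R : realType) (u : nat -> nat) (x l : R) : Prop :=
  (fun t : nat => (u t)%:R / x ^+ t) @ \oo --> l.

(* Main.v *)
Require Import Defs.
From mathcomp Require Import all_boot all_order all_algebra.
From mathcomp Require Import all_classical all_reals all_analysis.
From mathcomp Require Import separable finmap zify ring lra.

(** The obstacle is that the group is given by a presentation, so inequality of elements and lower
    bounds for lengths cannot be read off from words. No uniqueness of normal forms is proved; the
    action on ends serves as the invariant instead. Carrying a level along makes the cocycle
    identity part of the action law, and one construction covers two weights. With weight 0 the
    level counts syllables and records by how much an element shifts a periodic sequence; with
    weight [exp_len] it bounds word length from below. The assumption that k is at least 4 enters
    through strict dominance: both b and b^2 are then available as nontrivial syllables of different
    length, so two consecutive coefficients of the characteristic polynomial are nonzero. For k = 3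
    the polynomial would be x^2 - 2, whose two roots have equal modulus. *)

(* Up to conjugacy a reciprocal element is [a, h] for a (bb)-word h, whose
   exponent sequence is a palindrome up to sign. Z_2 * Z_k acts on the ends of
   its Bass-Serre tree, and the fixed ends of [a, h] are periodic sequences with
   the exponents of [a, h] as period; the associated Busemann cocycle gives the
   translation length. Hence the class of [a, h] has length 2t, where t is the
   weighted length of h, and two such classes agree only if the periodic
   sequences are shifts of each other. By the sign palindrome symmetry this
   leaves exactly two words h for each class, unless the sequence has a shorter
   period. In that case the sequence is determined by half a period, of weight at
   most t/2, so these exceptions (and with them all imprimitive classes) are
   exponentially negligible. Thus |R_2t| ~ |N_2t| / 2.

   The numbers |N_2t| satisfy a linear recurrence with simple characteristic
   roots lam_i, and Lagrange interpolation gives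
   |N_2t| = \sum_i lam_i^(t+m) / p'(lam_i). The positive root is strictly
   dominant, by the equality case of the triangle inequality. *)

Set Implicit Arguments.
Unset Strict Implicit.
Unset Printing Implicit Defensive.

Import Order.TTheory GRing.Theory Num.Theory.

Local Open Scope ring_scope.

(** * Elementary identities in the group and integer powers *)

Section GroupBasics.
Variable k : option nat.
Implicit Types g h : Z2free k.

Lemma mulg_of_word v w : (of_word k v * of_word k w)%g = of_word k (v ++ w).
Proof. exact: of_word_cat. Qed.

Lemma ga_sq : (ga * ga = 1 :> Z2free k)%g.
Proof. by rewrite mulg_of_word; apply/of_wordP/word_eq_aa. Qed.

Lemma gaV : (ga^-1 = ga :> Z2free k)%g.
Proof. by apply: mulg1_eq; apply: ga_sq. Qed.

Lemma gbV : (gb^-1 = of_word k [:: LbV])%g.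
Proof. by apply: mulg1_eq; rewrite mulg_of_word; apply/of_wordP/word_eq_bbV. Qed.

Lemma of_word_cons l w : of_word k (l :: w) = (of_word k [:: l] * of_word k w)%g.
Proof. by rewrite mulg_of_word. Qed.

Lemma of_word_nseq n : of_word k (nseq n Lb) = (gb ^+ n)%g.
Proof. by elim: n => // n IH; rewrite /= of_word_cons IH expgS. Qed.

Lemma gb_order n : k = Some n -> (gb ^+ n = 1 :> Z2free k)%g.
Proof. by move=> kn; rewrite -of_word_nseq; apply/of_wordP/word_eq_bk. Qed.

End GroupBasics.

Section IntPowers.
Variable G : groupType.
Implicit Types g : G.

Lemma expgzS g z : expgz g (1 + z) = (g * expgz g z)%g.
Proof.
case: z => n; first by rewrite /= expgS.
case: n => [|n]; first by rewrite /= mulgV.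
rewrite (_ : 1 + Negz n.+1 = Negz n); last by lia.
by rewrite /= [in RHS]expgSr invgM mulgA mulgV mul1g.
Qed.

Lemma expgzP g z : expgz g (-1 + z) = (g^-1 * expgz g z)%g.
Proof. by apply: (mulgI g); rewrite -expgzS mulVKg; congr expgz; ring. Qed.

Lemma expgzD g y z : expgz g (y + z) = (expgz g y * expgz g z)%g.
Proof.
elim: y => [|n IH|n IH].
- by rewrite add0r mul1g.
- by rewrite intS -addrA !expgzS IH mulgA.
- by rewrite intS opprD -addrA !expgzP IH mulgA.
Qed.

Lemma expgzN g z : expgz g (- z) = (expgz g z)^-1%g.
Proof. by apply/esym/mulg1_eq; rewrite -expgzD subrr. Qed.

Lemma expgz_mul_eq1 g (n : nat) z : (g ^+ n = 1)%g -> expgz g (n%:Z * z) = 1%g.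
Proof.
move=> gn; elim: z => [|m IH|m IH]; first by rewrite mulr0.
- by rewrite intS mulrDr mulr1 expgzD IH mulg1.
- by rewrite intS opprD mulrDr mulrN1 expgzD IH mulg1 expgzN /= gn invg1.
Qed.

End IntPowers.

(** * The action on the ends of the Bass-Serre tree *)

(* The cyclic group Z_k (or Z) of exponents of b, with a choice of
   representatives of minimal absolute value. *)
Record exponent_group (k : option nat) := ExponentGroup {
  exp_sort :> zmodType;
  exp1 : exp_sort;
  exp_rep : exp_sort -> int;
  exp1_order : forall n, k = Some n -> exp1 *+ n = 0;
  exp_repK : forall x, exp1 *~ exp_rep x = x;
  exp_rep0 : exp_rep 0 = 0;
  exp_repN : forall x, `|exp_rep (- x)|%N = `|exp_rep x|%N;
  exp_repD1 : forall x, (`|exp_rep (x + exp1)| <= `|exp_rep x|.+1)%N;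
  exp_2torsion : forall x y : exp_sort, x != 0 -> y != 0 -> x = - x -> y = - y -> x = y;
  exp_gb : forall z, exp1 *~ z = 0 -> expgz gb z = 1%g :> Z2free k
}.

Section Boundary.
Variables (k : option nat) (A : exponent_group k) (f : A -> int).
Hypothesis f0 : f 0 = 0.

(* The pair (xi, c) is the end b^(xi 0) a b^(xi 1) a ... of the Bass-Serre
   tree, together with a level c; the level makes the Busemann cocycle of the
   action part of the action. With f = 0 the cocycle counts syllables, and with
   f the length of an exponent it counts letters. *)
Definition leveled_end : Type := ((nat -> A) * int)%type.
Implicit Types (p : leveled_end) (g h : Z2free k).

Definition reduced (xi : nat -> A) := forall i, xi i.+1 != 0.

Definition act_a p : leveled_end :=
  if p.1 0%N == 0 then (fun i => p.1 i.+1, p.2 - 1)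
  else (fun i => if i is j.+1 then p.1 j else 0, p.2 + 1).

Definition act_b (x : A) p : leveled_end :=
  (fun i => if i is _.+1 then p.1 i else x + p.1 0%N,
   p.2 + (f (x + p.1 0%N) - f (p.1 0%N))).

Definition act_letter l :=
  match l with
  | La => act_a | Lb => act_b (exp1 A) | LbV => act_b (- exp1 A)
  end.

Definition act_word w p := foldr act_letter p w.

Definition act g p := act_word (to_word g) p.

Lemma act_b_reduced x p : reduced p.1 -> reduced (act_b x p).1.
Proof. by case: p => xi c rp i; apply: rp. Qed.

Lemma act_letter_reduced l p : reduced p.1 -> reduced (act_letter l p).1.
Proof.
case: l => //= rp; rewrite /act_a; case: eqP => // p0 -[|i] //=; exact/eqP.
Qed.

Lemma act_word_reduced w p : reduced p.1 -> reduced (act_word w p).1.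
Proof. by move=> rp; elim: w => //= l w; apply: act_letter_reduced. Qed.

Lemma act_aK p : reduced p.1 -> act_a (act_a p) = p.
Proof.
case: p => xi c /= rp; rewrite /act_a /=; case: (eqVneq (xi 0%N) 0) => [x0|x0] /=.
  rewrite (negPf (rp 0%N)) subrK; congr pair.
  by apply: boolp.funext => -[].
by rewrite eqxx addrK.
Qed.

Lemma act_b0 p : act_b 0 p = p.
Proof.
case: p => xi c; rewrite /act_b /= add0r subrr addr0; congr pair.
by apply: boolp.funext => -[].
Qed.

Lemma act_bD x y p : act_b (x + y) p = act_b x (act_b y p).
Proof.
case: p => xi c; rewrite /act_b /= -[x + y + _]addrA; congr pair; last by ring.
by apply: boolp.funext => -[].
Qed.

Lemma act_word_cat v w p : act_word (v ++ w) p = act_word v (act_word w p).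
Proof. exact: foldr_cat. Qed.

(** The defining relations act trivially, so the action descends to the group. Reducedness matters
    for a^2: after a leading 0 is dropped the next entry must be nonzero for a to put the 0 back. *)
Lemma act_word_eq v w p : word_eq k v w -> reduced p.1 -> act_word v p = act_word w p.
Proof.
move=> vw; elim: vw p => {v w} //=.
- by move=> v w _ IH p rp; rewrite IH.
- by move=> u v w _ IH1 _ IH2 p rp; rewrite IH1 // IH2.
- move=> v v' w w' _ IH1 _ IH2 p rp; rewrite !act_word_cat IH2 // IH1 //.
  exact: act_word_reduced.
- by move=> p; apply: act_aK.
- by move=> p rp; rewrite -act_bD subrr act_b0.
- by move=> p rp; rewrite -act_bD addNr act_b0.
- move=> n kn p rp; rewrite -[RHS](act_b0 p) -(exp1_order A kn).
  elim: n {kn} => [|n IH]; first by rewrite mulr0n act_b0.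
  by rewrite /= IH mulrS act_bD.
Qed.

Lemma act_reduced g p : reduced p.1 -> reduced (act g p).1.
Proof. exact: act_word_reduced. Qed.

Lemma act_of_word w p : reduced p.1 -> act (of_word k w) p = act_word w p.
Proof. by apply: act_word_eq; apply: of_word_repr. Qed.

Lemma act1 p : reduced p.1 -> act 1%g p = p.
Proof. exact: act_of_word. Qed.

Lemma actM g h p : reduced p.1 -> act (g * h)%g p = act g (act h p).
Proof.
move=> rp; rewrite -{1}(to_wordK g) -{1}(to_wordK h) mulg_of_word.
by rewrite act_of_word // act_word_cat.
Qed.

Lemma actK g p : reduced p.1 -> act g^-1%g (act g p) = p.
Proof. by move=> rp; rewrite -actM // mulVg act1. Qed.

Lemma act_ga p : reduced p.1 -> act ga p = act_a p.
Proof. exact: act_of_word. Qed.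

Lemma act_gbz z p : reduced p.1 -> act (expgz gb z) p = act_b (exp1 A *~ z) p.
Proof.
move=> rp; elim: z => [|n IH|n IH].
- by rewrite act1 // mulr0z act_b0.
- rewrite intS expgzS actM // IH act_of_word; last exact: act_b_reduced.
  by rewrite mulrzDr act_bD.
- rewrite intS opprD expgzP actM // IH gbV act_of_word; last exact: act_b_reduced.
  by rewrite mulrzDr mulrNz act_bD.
Qed.

Lemma act_word_shift w p d :
  act_word w (p.1, p.2 + d) = ((act_word w p).1, (act_word w p).2 + d).
Proof.
elim: w => //= l w ->; case: (act_word w p) => xi c.
by case: l; rewrite /= /act_a /act_b /=; do ?case: ifP => _; congr pair; rewrite addrAC.
Qed.

Lemma act_shift g p d : act g (p.1, p.2 + d) = ((act g p).1, (act g p).2 + d).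
Proof. exact: act_word_shift. Qed.

(** With weight 0, the change of level is the shift under which the old and the new end agree far
    out. *)
Lemma act_tail g p : (forall x, f x = 0) -> exists m n : nat,
  (act g p).2 - p.2 = m%:Z - n%:Z /\ forall i, (act g p).1 (i + m)%N = p.1 (i + n)%N.
Proof.
clear f0; move=> ff; rewrite /act; elim: (to_word g) => [|l w [m [n [cmn tail]]]] /=.
  by exists 0%N, 0%N; split=> //; rewrite !subrr.
move: tail cmn; move: (act_word w p) => [xi c] /= tail cmn.
have act_b_tail x : exists m n : nat, (act_b x (xi, c)).2 - p.2 = m%:Z - n%:Z /\
    forall i, (act_b x (xi, c)).1 (i + m)%N = p.1 (i + n)%N.
  exists m.+1, n.+1; split; first by rewrite /= !ff; lia.
  by move=> i; rewrite !addnS /= -addSn tail addSn.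
case: l; [|exact: act_b_tail..]; rewrite /= /act_a; case: ifP => _ /=.
  exists m, n.+1; split; first by lia.
  by move=> i; rewrite -addSn tail addnS addSn.
exists m.+1, n; split; first by lia.
by move=> i; rewrite addnS tail.
Qed.

Fixpoint ab_prod (s : seq int) : Z2free k :=
  if s is z :: s' then (ga * expgz gb z * ab_prod s')%g else 1%g.

Lemma ab_prod_cat s1 s2 : ab_prod (s1 ++ s2) = (ab_prod s1 * ab_prod s2)%g.
Proof. by elim: s1 => /= [|z s ->]; rewrite ?mul1g ?mulgA. Qed.

Fixpoint stream_cat (s : seq int) (u : nat -> A) : nat -> A :=
  if s is z :: s' then fun i => if i is j.+1 then stream_cat s' u j else exp1 A *~ z
  else u.

Lemma stream_cat_nth s u i :
  stream_cat s u i = if (i < size s)%N then exp1 A *~ s`_i else u (i - size s)%N.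
Proof. by elim: s i => [|z s IH] [|i] //=; rewrite IH ltnS subSS. Qed.

Definition stream_end (u : nat -> A) : nat -> A := fun i => if i is j.+1 then u j else 0.

Definition nz_exps (s : seq int) := all (fun z => exp1 A *~ z != 0) s.

Definition flen (s : seq int) : int := \sum_(z <- s) (f (exp1 A *~ z) + 1).

Lemma act_ab_prod s u c : nz_exps s -> (forall i, u i != 0) ->
  act (ab_prod s) (stream_end u, c) = (stream_end (stream_cat s u), c + flen s).
Proof.
rewrite /flen; move=> + ur; elim: s => [_|z s IH /= /andP[z0 sr]].
  by rewrite act1 // big_nil addr0.
have red : reduced (stream_end (stream_cat s u)).
  move=> i /=; rewrite stream_cat_nth; case: ltnP => // si.
  by move/allP: sr; apply; apply: mem_nth.
rewrite big_cons !actM // IH // ?act_gbz // act_ga; last exact: red.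
rewrite /act_a /act_b /= addr0 (negPf z0) f0 subr0; congr pair; last by ring.
by apply: boolp.funext => -[|[|i]].
Qed.

Lemma act_ab_prod_fixed s xi c : nz_exps s -> (0 < size s)%N -> reduced xi -> xi 0%N = 0 ->
  act (ab_prod s) (xi, c) = (xi, (act (ab_prod s) (xi, c)).2) ->
  xi = stream_end (fun i => exp1 A *~ s`_(i %% size s)).
Proof.
move=> sr s0 rxi xi0; set u := fun i => xi i.+1.
have -> : xi = stream_end u by apply: boolp.funext => -[].
rewrite act_ab_prod // => -[] /(congr1 (fun v => fun i => v i.+1)) /= uE.
congr stream_end; apply: boolp.funext => i.
elim/ltn_ind: i => i IH; rewrite -[LHS](congr1 (@^~ i) uE) stream_cat_nth.
case: ltnP => [lt|le]; first by rewrite modn_small.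
rewrite IH; last by rewrite -subn_gt0 subKn.
by congr (_ *~ nth _ _ _); rewrite -[in RHS](subnK le) modnDr.
Qed.

Lemma act_ab_prod_periodic s c : nz_exps s -> (0 < size s)%N ->
  let xi := stream_end (fun i => exp1 A *~ s`_(i %% size s)) in
  act (ab_prod s) (xi, c) = (xi, c + flen s).
Proof.
move=> sr s0 /=; rewrite act_ab_prod // => [|i]; last first.
  by move/allP: sr; apply; apply/mem_nth; rewrite ltn_mod.
congr (stream_end _, _); apply: boolp.funext => i; rewrite stream_cat_nth.
case: ltnP => [lt|le]; first by rewrite modn_small.
by congr (_ *~ nth _ _ _); rewrite -[in RHS](subnK le) modnDr.
Qed.

End Boundary.

(** * The commutators [a, h] up to conjugacy *)

Section Commutators.
Variables (k : option nat) (A : exponent_group k).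
Implicit Types (s : seq int) (z : int).

Local Notation phi z := (exp1 A *~ z).
Local Notation ab_prod := (@ab_prod k).

(** For [Zp_exponents] this is membership in E_k; for [int_exponents] it says that z is nonzero. *)
Definition normal_exp z := (z != 0) && (exp_rep (phi z) == z).

Definition opp_rev s := rev (map -%R s).

(** The second half keeps raw negatives, which need not be normal: for k = 2m the entry -m lies
    outside E_k. Only the residues and their lengths matter later. *)
Definition palindrome s := s ++ opp_rev s.

(* The exponents of h^-1, for a word h with exponents s. *)
Definition refl_seq s := rev [seq exp_rep (- phi z) | z <- s].

Definition comm_elt s : Z2free k := ab_prod (palindrome s).

Lemma normal_exp_neq0 z : normal_exp z -> phi z != 0.
Proof. by case/andP=> z0 /eqP zz; apply: contraNneq z0 => h; rewrite -zz h exp_rep0. Qed.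

Lemma normal_exp_rep (x : A) : x != 0 -> normal_exp (exp_rep x).
Proof.
move=> x0; rewrite /normal_exp exp_repK eqxx andbT; apply: contraNneq x0 => h.
by rewrite -[x]exp_repK h.
Qed.

Lemma normal_exp_inj : {in normal_exp &, injective (fun z => phi z)}.
Proof. by move=> y z /andP[_ /eqP yy] /andP[_ /eqP zz] e; rewrite -yy -zz e. Qed.

Lemma size_opp_rev s : size (opp_rev s) = size s.
Proof. by rewrite size_rev size_map. Qed.

Lemma size_palindrome s : size (palindrome s) = (2 * size s)%N.
Proof. by rewrite size_cat size_opp_rev mul2n addnn. Qed.

Lemma nz_palindrome s : all normal_exp s -> nz_exps A (palindrome s).
Proof.
move=> Es; rewrite /nz_exps all_cat all_rev all_map.
by apply/andP; split; apply: sub_all Es => z /normal_exp_neq0 //=; rewrite mulrNz oppr_eq0.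
Qed.

Lemma ab_prod_opp_rev s : ab_prod (opp_rev s) = (ga * (ab_prod s)^-1 * ga)%g.
Proof.
elim: s => [|z s IH] /=; first by rewrite invg1 mulg1 ga_sq.
rewrite /opp_rev /= rev_cons -cats1 ab_prod_cat IH /= mulg1 expgzN !invgM gaV.
by rewrite !mulgA -[(_ * ga * ga)%g]mulgA ga_sq mulg1 -[RHS]mulgA ga_sq mulg1.
Qed.

(** Regrouped as (g a g^-1) a with g = [ab_prod s], this exhibits a product of two conjugates of
    a. *)
Lemma comm_eltE s : comm_elt s = (ab_prod s * (ga * (ab_prod s)^-1 * ga))%g.
Proof. by rewrite /comm_elt ab_prod_cat ab_prod_opp_rev. Qed.

Lemma ab_prod_bb_elt x xs : ab_prod (x :: xs) = (ga * bb_elt k x xs)%g.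
Proof.
elim: xs x => [|y xs IH] x; first by rewrite /= mulg1.
by rewrite [LHS]/= -/(ab_prod (y :: xs)) IH /= !mulgA.
Qed.

Lemma comm_elt_bb x xs (h := bb_elt k x xs) :
  comm_elt (x :: xs) = (ga * h * ga^-1 * h^-1)%g.
Proof.
by rewrite comm_eltE ab_prod_bb_elt invgM gaV -!mulgA ga_sq mulg1.
Qed.

Lemma comm_elt_inv s : (comm_elt s)^-1%g = (ga * comm_elt s * ga)%g.
Proof.
by rewrite comm_eltE !invgM invgK gaV !mulgA -[RHS]mulgA ga_sq mulg1.
Qed.

Lemma ab_prod_congr s1 s2 : [seq phi z | z <- s1] = [seq phi z | z <- s2] -> ab_prod s1 = ab_prod s2.
Proof.
elim: s1 s2 => [|y s1 IH] [|z s2] //= [yz /IH ->]; congr (_ * _ * _)%g.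
rewrite -[y](subrK z) expgzD (@exp_gb _ A) ?mul1g //.
by rewrite mulrzBr yz subrr.
Qed.

(** Conjugation by [ab_prod s] rotates the palindrome by half its length. The result
    [opp_rev s ++ s] is again a palindrome, with first half [refl_seq s] up to the choice of
    representatives. *)
Lemma comm_elt_refl s : comm_elt (refl_seq s) = (comm_elt s ^ ab_prod s)%g.
Proof.
have -> : comm_elt (refl_seq s) = ab_prod (opp_rev s ++ s).
  apply: ab_prod_congr; rewrite /palindrome !map_cat; congr (_ ++ _).
    rewrite /refl_seq /opp_rev !map_rev -!map_comp; congr rev.
    by apply: eq_map => z /=; rewrite exp_repK mulrNz.
  rewrite /refl_seq /opp_rev !map_rev revK -!map_comp.
  by apply: eq_map => z /=; rewrite mulrNz exp_repK opprK.
by rewrite /comm_elt !ab_prod_cat conjgE -mulgA mulKg.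
Qed.

(** * Fixed ends of [a, h] and the change of level there *)

Section FixedEnds.
Variable f : A -> int.
Hypothesis f0 : f 0 = 0.

Definition end_of s : nat -> A :=
  stream_end (fun i => phi (palindrome s)`_(i %% size (palindrome s))).

Lemma end_of_reduced s : all normal_exp s -> (0 < size s)%N -> reduced (end_of s).
Proof.
move=> Es s0 i; have /allP := nz_palindrome Es; apply; apply: mem_nth.
by rewrite ltn_mod size_palindrome muln_gt0.
Qed.

Lemma act_comm_elt s c : all normal_exp s -> (0 < size s)%N ->
  act f (comm_elt s) (end_of s, c) = (end_of s, c + flen f (palindrome s)).
Proof.
move=> Es s0; apply: act_ab_prod_periodic => //; first exact: nz_palindrome.
by rewrite size_palindrome muln_gt0.
Qed.

(* The other fixed end is the image of end_of s under a, since a inverts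
   [a, h]; there the level decreases. *)
Lemma act_comm_elt_fixed s xi c d : all normal_exp s -> (0 < size s)%N ->
    0 < flen f (palindrome s) -> reduced xi -> 0 < d ->
    act f (comm_elt s) (xi, c) = (xi, c + d) ->
  xi = end_of s /\ d = flen f (palindrome s).
Proof.
move=> Es s0 fl0 rxi d0 fixxi.
have pos : (0 < size (palindrome s))%N by rewrite size_palindrome muln_gt0.
have head0 eta c' d' : reduced eta -> eta 0%N = 0 ->
    act f (comm_elt s) (eta, c') = (eta, c' + d') ->
    eta = end_of s /\ d' = flen f (palindrome s).
  move=> reta eta0 fixeta.
  have e := act_ab_prod_fixed f0 (nz_palindrome Es) pos reta eta0 (c := c').
  have {}e : eta = end_of s by apply: e; rewrite -/(comm_elt s) fixeta.
  by split=> //; move: fixeta; rewrite e act_comm_elt // => -[] /addrI ->.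
case: (eqVneq (xi 0%N) 0) => [xi0|xi0]; first exact: head0 fixxi.
have ra : reduced (act_a (xi, c)).1 by apply: (act_letter_reduced f La).
have shiftV : act f (comm_elt s)^-1%g (xi, c) = (xi, c - d).
  have := act_shift f (comm_elt s) (xi, c) (- d).
  rewrite fixxi /= addrK => e; rewrite -[in LHS]e actK //.
have : act f (comm_elt s) (act_a (xi, c)) = ((act_a (xi, c)).1, (act_a (xi, c)).2 + - d).
  rewrite -(act_ga f) // -actM //.
  have -> : (comm_elt s * ga = ga * (comm_elt s)^-1)%g.
    by rewrite comm_elt_inv !mulgA ga_sq mul1g.
  rewrite actM // shiftV !act_ga // /act_a /= (negPf xi0) /=; congr pair; ring.
rewrite {1}[act_a _]surjective_pairing => fixa.
have [|_ dE] := head0 _ _ _ ra _ fixa; first by rewrite /act_a /= (negPf xi0).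
by move: fl0; rewrite -dE; lia.
Qed.

(** The image under u of the first fixed end is fixed by the second element with the same positive
    change of level, and only one end has this property. *)
Lemma act_conj_end s s' u : all normal_exp s -> all normal_exp s' ->
    (0 < size s)%N -> (0 < size s')%N ->
    0 < flen f (palindrome s) -> 0 < flen f (palindrome s') ->
    (u * comm_elt s = comm_elt s' * u)%g ->
  (act f u (end_of s, 0)).1 = end_of s' /\ flen f (palindrome s) = flen f (palindrome s').
Proof.
move=> Es Es' s0 s0' fl fl' us; set p := act f u _.
have rs := end_of_reduced Es s0.
apply: (act_comm_elt_fixed (c := p.2)) => //; first exact: act_reduced.
rewrite -surjective_pairing -actM // -us actM // act_comm_elt //.
exact: (act_shift f u (end_of s, 0)).
Qed.

End FixedEnds.

(* The bi-infinite periodic sequence of exponents along the axis of [a, h]. *)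
Definition biinf s (i : int) : A := phi (palindrome s)`_`|(i %% (2 * size s)%:Z)%Z|.

Lemma biinf_nat s (i : nat) :
  biinf s i%:Z = phi (palindrome s)`_(i %% size (palindrome s)).
Proof. by rewrite /biinf modz_nat size_palindrome. Qed.

Lemma biinf_period s (i q : int) : biinf s (i + q * (2 * size s)%:Z) = biinf s i.
Proof. by rewrite /biinf addrC modzMDl. Qed.

Lemma biinf_small s (i : nat) : (i < size s)%N -> biinf s i%:Z = phi s`_i.
Proof.
move=> lt; rewrite biinf_nat modn_small ?nth_cat ?lt // size_palindrome.
by rewrite mul2n -addnn ltn_addr.
Qed.

Lemma palindrome_anti s i : (i < 2 * size s)%N ->
  (palindrome s)`_((2 * size s).-1 - i) = - (palindrome s)`_i.
Proof.
have opp_revK : opp_rev (palindrome s) = palindrome s.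
  rewrite /opp_rev /palindrome map_cat rev_cat; congr (_ ++ _).
  by rewrite /opp_rev map_rev revK -map_comp map_id_in // => z _ /=; rewrite opprK.
move=> lt; rewrite -{1}opp_revK /opp_rev nth_rev size_map size_palindrome; last by lia.
rewrite (nth_map (0 : int)) ?size_palindrome; last by lia.
by congr (- _`_ _); lia.
Qed.

(** This reflection about the midpoint of -1 and 0 reflects the fact that a inverts [a, h]. *)
Lemma biinf_anti s i : (0 < size s)%N -> biinf s (- 1 - i) = - biinf s i.
Proof.
move=> s0; rewrite /biinf -mulrNz; set N := (2 * size s)%N.
have N0 : N%:Z != 0 by rewrite /N; lia.
set r := (i %% N)%Z.
have r0 : 0 <= r by rewrite modz_ge0.
have rN : r < N%:Z by rewrite ltz_pmod // /N; lia.
have -> : ((- 1 - i) %% N = N%:Z - 1 - r)%Z.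
  rewrite {1}(divz_eq i N) -/r.
  have -> : -1 - ((i %/ N)%Z * N + r) = (- (i %/ N)%Z - 1) * N + (N%:Z - 1 - r) by ring.
  by rewrite modzMDl modz_small //; lia.
rewrite -palindrome_anti -/N; last by lia.
by congr (phi (palindrome s)`_ _); lia.
Qed.

Lemma eq_biinf s s' (e : int) : (0 < size s)%N -> size s = size s' ->
  (exists N : nat, forall i : nat, (N <= i)%N -> biinf s' (i%:Z + e) = biinf s i%:Z) ->
  forall i, biinf s' (i + e) = biinf s i.
Proof.
move=> s0 ss [N eN] i.
(* Both sequences have period [2 * size s]; adding N + |i| periods moves the index beyond N. *)
rewrite -(biinf_period s i (N + `|i|)%N%:Z) -(biinf_period s' (i + e) (N + `|i|)%N%:Z) -ss.
have [j jE] : exists j : nat, i + (N + `|i|)%N%:Z * (2 * size s)%:Z = j%:Z.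
  by exists (absz (i + (N + `|i|)%N%:Z * (2 * size s)%:Z)); nia.
have Nj : (N <= j)%N by nia.
by rewrite addrAC jE eN.
Qed.

Lemma flen0_palindrome s : flen (fun _ : A => 0) (palindrome s) = (2 * size s)%:Z.
Proof.
rewrite /flen; under eq_bigr do rewrite add0r.
by rewrite big_const_seq count_predT iter_addr_0 size_palindrome natz.
Qed.

(** With weight 0 the translation length is the number of syllables, hence the sizes agree. The
    tails of the two fixed ends then differ by the level of the image, and periodicity extends this
    to all indices. *)
Lemma conj_comm_elt s s' u : all normal_exp s -> all normal_exp s' ->
    (0 < size s)%N -> (0 < size s')%N -> (u * comm_elt s = comm_elt s' * u)%g ->
  size s = size s' /\ exists e,
    act (fun _ : A => 0) u (end_of s, 0) = (end_of s', e) /\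
    forall i, biinf s' (i + e) = biinf s i.
Proof.
move=> Es Es' s0 s0' us.
have [] := act_conj_end (f := fun _ => 0) erefl Es Es' s0 s0' _ _ us;
  rewrite ?flen0_palindrome ?muln_gt0 //; try by lia.
move=> e1 ss; have {}ss : size s = size s' by lia.
split=> //; exists (act (fun=> 0) u (end_of s, 0)).2; split.
  by rewrite -e1 -surjective_pairing.
apply: eq_biinf => //.
have [m [n [mn tail]]] := act_tail u (end_of s, 0) (f := fun _ : A => 0) (fun _ => erefl).
exists n => i ni; rewrite -[_.2]subr0 mn.
have -> : i%:Z + (m%:Z - n%:Z) = (i - n + m)%N%:Z by lia.
(* The successor skips the leading 0 that [stream_end] puts before the periodic sequence. *)
move: (tail (i - n).+1); rewrite !addSn e1 /=.
by rewrite (subnK ni) !biinf_nat.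
Qed.

Definition aperiodic s := forall d : int,
  (forall i, biinf s (i + d) = biinf s i) -> ((2 * size s)%:Z %| d)%Z.

Lemma biinf_inj s s' : all normal_exp s -> all normal_exp s' -> size s = size s' ->
  (forall i, (i < size s)%N -> biinf s i%:Z = biinf s' i%:Z) -> s = s'.
Proof.
move=> /allP Es /allP Es' ss e; apply: (@eq_from_nth int 0) => // i lt.
have := e i lt; rewrite !biinf_small -?ss //.
by apply: normal_exp_inj; [apply: Es|apply: Es']; apply: mem_nth; rewrite -?ss.
Qed.

Lemma size_refl s : size (refl_seq s) = size s.
Proof. by rewrite size_rev size_map. Qed.

Lemma normal_refl s : all normal_exp s -> all normal_exp (refl_seq s).
Proof.
move=> Es; rewrite all_rev all_map; apply: sub_all Es => z /normal_exp_neq0 z0 /=.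
by rewrite normal_exp_rep // oppr_eq0.
Qed.

Lemma biinf_reflect s i : (i < size s)%N ->
  biinf s (i%:Z + (size s)%:Z) = - phi s`_(size s - i.+1).
Proof.
move=> lt; have s0 : (0 < size s)%N by apply: leq_ltn_trans lt.
rewrite -biinf_small; last by lia.
rewrite -biinf_anti // -(biinf_period s (- 1 - _) 1); congr biinf; lia.
Qed.

(* Composing the shift with the reflections shows that 2e is a period, so e is a
   multiple of half the period 2 * size s. *)
Lemma reflect_cases s s' e : all normal_exp s -> all normal_exp s' ->
    (0 < size s)%N -> size s = size s' -> (forall i, biinf s' (i + e) = biinf s i) ->
  aperiodic s -> s' = s \/ s' = refl_seq s.
Proof.
move=> Es Es' s0 ss Y ap.
have /ap : forall i, biinf s (i + - (2 * e)) = biinf s i.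
  move=> i; apply: oppr_inj; rewrite -(biinf_anti i s0) -(Y (- 1 - i)).
  have -> : - 1 - i + e = - 1 - (i - 2 * e + e) by ring.
  by rewrite biinf_anti -?ss // Y.
case/dvdzP=> q qE.
have {qE} eE : e = - q * (size s)%:Z by lia.
(* For even q the shift is by full periods and gives s; for odd q it lands on the second half of the
   palindrome, which reads [refl_seq s]. *)
case: (intP (q %% 2)%Z) (divz_eq q 2) (ltz_pmod q (d := 2) isT) (modz_ge0 q (d := 2) isT).
- move=> qE _ _; left; apply: biinf_inj => // i si.
  rewrite -[RHS]Y eE qE -[RHS](biinf_period _ _ (q %/ 2)%Z) -ss.
  by congr biinf; ring.
- move=> [|n] qE; last by lia.
  move=> _ _; right; apply: biinf_inj; rewrite ?normal_refl ?size_refl // => i si.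
  rewrite -ss in si.
  rewrite [RHS]biinf_small ?size_refl // /refl_seq nth_rev size_map //.
  rewrite (nth_map (0 : int)) ?exp_repK -?biinf_reflect ?ltn_subrL //.
  rewrite -[RHS]Y eE qE -[RHS](biinf_period _ _ (q %/ 2)%Z) -ss.
  by congr biinf; ring.
- by move=> n; lia.
Qed.

Lemma aperiodic_shift s s' e : size s = size s' ->
  (forall i, biinf s' (i + e) = biinf s i) -> aperiodic s -> aperiodic s'.
Proof.
move=> ss Y ap d per; rewrite -ss; apply: ap => i.
by rewrite -!Y addrAC per.
Qed.

Lemma aperiodic_refl s : all normal_exp s -> (0 < size s)%N ->
  aperiodic s -> aperiodic (refl_seq s).
Proof.
move=> Es s0 ap.
have us : ((ab_prod s)^-1 * comm_elt s = comm_elt (refl_seq s) * (ab_prod s)^-1)%g.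
  by rewrite comm_elt_refl conjgE -!mulgA mulgV mulg1.
have s0' : (0 < size (refl_seq s))%N by rewrite size_refl.
have [ss [e [_ Y]]] := conj_comm_elt Es (normal_refl Es) s0 s0' us.
exact: aperiodic_shift ss Y ap.
Qed.

(** Otherwise the two halves of the palindrome would have equal residues, and half of the least
    period would be a period. *)
Lemma aperiodic_refl_neq s : all normal_exp s -> (0 < size s)%N ->
  aperiodic s -> refl_seq s <> s.
Proof.
move=> Es s0 ap ss.
have Y i : (i < size s)%N -> biinf s (i%:Z + (size s)%:Z) = biinf s i%:Z.
  move=> lt; rewrite biinf_reflect // biinf_small // -[in RHS]ss /refl_seq.
  by rewrite nth_rev size_map // (nth_map (0 : int)) ?exp_repK ?ltn_subrL ?s0.
have /ap : forall i, biinf s (i + (size s)%:Z) = biinf s i.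
  move=> i; set n := (size s)%:Z.
  have nE : (2 * size s)%:Z = 2 * n by lia.
  have n0 : 0 < 2 * n by lia.
  rewrite (divz_eq i (2 * n)); move: (i %/ _)%Z => q.
  have := modz_ge0 i (d := 2 * n) (lt0r_neq0 n0); have := ltz_pmod i n0.
  move: (i %% _)%Z => r rlt r0.
  rewrite [q * _ + r]addrC addrAC -nE !biinf_period.
  case: (ltP r n) => rn.
    have -> : r = `|r|%N by lia.
    by apply: Y; lia.
  have rE : r = `|r - n|%N%:Z + n by lia.
  rewrite [in RHS]rE Y; last by lia.
  rewrite -[RHS](biinf_period _ _ 1); congr biinf; lia.
by rewrite dvdzE => /(dvdn_leq s0) /=; lia.
Qed.

End Commutators.

(** * Word lengths and reciprocal geodesics *)

Lemma min_natE (P : set nat) n : P n -> (forall m, P m -> (n <= m)%N) -> min_nat P = n.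
Proof.
move=> Pn minn; apply: xget_unique => // m [Pm minm].
by apply/eqP; rewrite eqn_leq minm // minn.
Qed.

Definition wlen (s : seq int) : nat := (\sum_(z <- s) `|z|.+1)%N.

Section Lengths.
Variables (k : option nat) (A : exponent_group k).
Implicit Types (s : seq int) (z : int) (g h : Z2free k).

Local Notation phi z := (exp1 A *~ z).
Local Notation ab_prod := (@ab_prod k).
Local Notation normal := (all (normal_exp A)).

Definition exp_len (x : A) : int := `|exp_rep x|%N%:Z.

Lemma exp_len0 : exp_len 0 = 0.
Proof. by rewrite /exp_len exp_rep0. Qed.

Definition generators : seq (Z2free k) := [:: ga; gb; gb^-1]%g.

Lemma exp_len_step (x : A) :
  exp_len (exp1 A + x) <= exp_len x + 1 /\ exp_len (- exp1 A + x) <= exp_len x + 1.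
Proof.
rewrite /exp_len -!PoszD !lez_nat !addn1 [exp1 A + x]addrC exp_repD1; split=> //.
by rewrite -(exp_repN (- exp1 A + x)) -(exp_repN x) opprD opprK addrC exp_repD1.
Qed.

Lemma act_generator_le g (p : leveled_end A) : g \in generators -> reduced p.1 ->
  (act exp_len g p).2 <= p.2 + 1.
Proof.
move=> + rp; rewrite !inE => /or3P[] /eqP->; rewrite ?gbV act_of_word //=.
- by rewrite /act_a; case: ifP => _ /=; lia.
- by have [+ _] := exp_len_step (p.1 0%N); rewrite lerD2l lerBlDl.
- by have [_ +] := exp_len_step (p.1 0%N); rewrite lerD2l lerBlDl.
Qed.

Lemma act_prod_le (w : seq (Z2free k)) (p : leveled_end A) : {subset w <= generators} ->
  reduced p.1 -> (act exp_len (\prod_(g <- w) g)%g p).2 <= p.2 + (size w)%:Z.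
Proof.
move=> + rp; elim: w => [|g w IH] gw; first by rewrite big_nil act1 //= addr0.
rewrite big_cons actM //; apply: le_trans (act_generator_le _ _) _.
- by apply: gw; rewrite mem_head.
- exact: act_reduced.
- have : {subset w <= generators} by move=> h hw; apply: gw; rewrite inE hw orbT.
  by move/IH => /=; lia.
Qed.

Lemma ab_prod_word s : exists w, [/\ {subset w <= generators},
  ab_prod s = (\prod_(g <- w) g)%g & size w = wlen s].
Proof.
rewrite /wlen; elim: s => [|z s [w [ww ws sw]]].
  by exists [::]; rewrite !big_nil.
exists (ga :: nseq `|z|%N (if 0 <= z then gb else gb^-1)%g ++ w); split.
- move=> g; rewrite inE mem_cat mem_nseq => /or3P[/eqP->|/andP[_ /eqP->]|/ww//].
    by rewrite !inE eqxx.
  by case: ifP; rewrite !inE eqxx ?orbT.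
- rewrite big_cons big_cat /= ws !mulgA; congr (_ * _ * _)%g.
  rewrite big_nseq iter_mulg_1.
  by case: z => n //=; rewrite expVgn.
- by rewrite /= size_cat size_nseq big_cons sw.
Qed.

Lemma flen_palindrome s : normal s -> flen exp_len (palindrome s) = (2 * wlen s)%N%:Z.
Proof.
rewrite /flen big_cat /= /opp_rev /wlen.
rewrite big_rev big_map -big_split /=.
elim: s => [|z s IH]; first by rewrite !big_nil.
case/andP=> /andP[_ /eqP zz] /IH; rewrite !big_cons => ->.
by rewrite /exp_len mulrNz exp_repN zz; lia.
Qed.

Lemma wlen_cat s1 s2 : wlen (s1 ++ s2) = (wlen s1 + wlen s2)%N.
Proof. by rewrite /wlen big_cat. Qed.

Lemma wlen_opp_rev s : wlen (opp_rev s) = wlen s.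
Proof. by rewrite /wlen /opp_rev big_rev big_map; apply: eq_bigr => z _; rewrite abszN. Qed.

Lemma wlen_gt0 s : (0 < size s)%N -> (0 < wlen s)%N.
Proof. by case: s => //= z s _; rewrite /wlen big_cons. Qed.

(* A conjugate of [a, h] fixes an end with the same change of level, and a single
   letter changes the level by at most 1. *)
Lemma conj_length_ge s u (w : seq (Z2free k)) : normal s -> (0 < size s)%N ->
    {subset w <= generators} -> (comm_elt k s ^ u = \prod_(g <- w) g)%g ->
  (2 * wlen s <= size w)%N.
Proof.
move=> Es s0 ww ew; have rs := end_of_reduced Es s0.
pose p := act exp_len u^-1%g (end_of A s, 0).
have rp : reduced p.1 by apply: act_reduced.
have := act_prod_le ww rp; rewrite -ew.
have -> : act exp_len (comm_elt k s ^ u)%g p = (p.1, p.2 + (2 * wlen s)%N%:Z).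
  rewrite /p -actM // conjgE -!mulgA mulgV mulg1 actM //.
  rewrite (act_comm_elt exp_len0) // flen_palindrome //.
  exact: (act_shift exp_len _ (end_of A s, 0)).
by rewrite /=; lia.
Qed.

Lemma word_length_comm_elt s : normal s -> (0 < size s)%N ->
  word_length (comm_elt k s) = (2 * wlen s)%N.
Proof.
move=> Es s0; apply: min_natE => [|_ [w [ww ew] <-]].
  have [w [ww ew sw]] := ab_prod_word (palindrome s); exists w => //.
  by rewrite sw wlen_cat wlen_opp_rev mul2n addnn.
by apply: (conj_length_ge (u := 1%g)) ww _ => //; rewrite conjg1.
Qed.

(** The default value of [min_nat] on the empty set has to be excluded: every element is a product
    of generators, so the minimum is attained. *)
Lemma word_length_word g : exists w : seq (Z2free k),
  [/\ {subset w <= generators}, g = (\prod_(x <- w) x)%g & size w = word_length g].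
Proof.
have [w0 [ww0 gw0]] : exists w : seq (Z2free k),
    {subset w <= generators} /\ g = (\prod_(x <- w) x)%g.
  rewrite -(to_wordK g); elim: (to_word g) => [|l w [v [vg vE]]].
    by exists [::]; rewrite big_nil.
  exists (of_word k [:: l] :: v); rewrite big_cons -vE mulg_of_word; split=> // x.
  by rewrite inE => /orP[/eqP->|/vg//]; rewrite !inE gbV; case: l; rewrite eqxx ?orbT.
pose P n := `[< exists w : seq (Z2free k), [/\ {subset w <= generators},
  g = (\prod_(x <- w) x)%g & size w = n] >].
have exP : exists n, P n by exists (size w0); apply/asboolP; exists w0.
have [n /asboolP[w [ww gw sw]] nmin] := ex_minnP exP.
exists w; split=> //; rewrite sw; apply/esym/min_natE; first by exists w.
by move=> _ [v [vg gv] <-]; apply: nmin; apply/asboolP; exists v.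
Qed.

Lemma class_length_comm_elt s : normal s -> (0 < size s)%N ->
  class_length (conj_class (comm_elt k s)) = (2 * wlen s)%N.
Proof.
move=> Es s0; apply: min_natE => [|_ [h [u ->] <-]].
  by exists (comm_elt k s); [exists 1%g; rewrite conjg1|exact: word_length_comm_elt].
have [w [ww ew <-]] := word_length_word (comm_elt k s ^ u)%g.
exact: conj_length_ge Es s0 ww ew.
Qed.

Lemma comm_elt_neq1 s : normal s -> (0 < size s)%N -> comm_elt k s <> 1%g.
Proof.
move=> Es s0 e; have := conj_length_ge (u := 1%g) (w := [::]) Es s0.
rewrite big_nil conjg1 e => /(_ _ erefl); have := wlen_gt0 s0.
by move=> w0 H; have /H : {subset [::] <= generators} by []; rewrite /=; lia.
Qed.

(** Only existence of such a form is used, to bring every reciprocal class to the shape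
    [comm_elt]. *)
Definition has_normal_form (g : Z2free k) := exists (b b' : bool) s,
  normal s /\ g = ((ga ^+ b) * ab_prod s * (ga ^+ b'))%g.

Lemma normal_form_gb z s (b' : bool) : normal s ->
  has_normal_form (expgz gb z * ab_prod s * (ga ^+ b'))%g.
Proof.
move=> Es; case: (eqVneq (phi z) 0) => [z0|z0].
  by exists false, b', s; split=> //; rewrite (exp_gb z0).
exists true, b', (exp_rep (phi z) :: s); split; first by rewrite /= normal_exp_rep.
have -> : expgz gb z = expgz gb (exp_rep (phi z)) :> Z2free k.
  rewrite -[LHS]mul1g -[in LHS](subrK (exp_rep (phi z)) z) expgzD mul1g.
  by rewrite (@exp_gb _ A) ?mul1g // mulrzBr exp_repK subrr.
by rewrite /= !mulgA ga_sq mul1g.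
Qed.

Lemma ga_exp (b : bool) : (ga * ga ^+ b = ga ^+ nat_of_bool (~~ b) :> Z2free k)%g.
Proof. by case: b; rewrite /= ?ga_sq // mulg1. Qed.

Lemma normal_formP g : has_normal_form g.
Proof.
have step_gb z h : has_normal_form h -> has_normal_form (expgz gb z * h)%g.
  case=> b [b' [s [Es ->]]]; case: b => /=; last by rewrite mul1g mulgA; exact: normal_form_gb.
  case: s Es => [_|y s /andP[_ Es]] /=.
    have := normal_form_gb z (s := [::]) (~~ b') isT.
    by rewrite -ga_exp /= !mulg1 !mulgA.
  have := normal_form_gb (z + y) b' Es.
  rewrite expgzD !mulgA.
  by rewrite -[(expgz _ _ * ga * ga)%g]mulgA ga_sq mulg1.
rewrite -(to_wordK g); elim: (to_word g) => [|l w IH].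
  by exists false, false, [::]; split=> //=; rewrite !mulg1.
rewrite of_word_cons; case: l.
- case: IH => b [b' [s [Es ->]]]; exists (~~ b), b', s; split=> //.
  by rewrite -ga_exp !mulgA.
- exact: (step_gb 1).
- by rewrite -gbV; exact: (step_gb (- 1)).
Qed.

Lemma conj_classJ (g u : Z2free k) : conj_class (g ^ u)%g = conj_class g.
Proof.
apply/seteqP; split=> _ [y ->]; first by exists (u * y)%g; rewrite conjgM.
by exists (u^-1 * y)%g; rewrite -conjgM mulVKg.
Qed.

Lemma reciprocal_geodesicP (C : set (Z2free k)) : reciprocal_geodesic C <->
  exists s, [/\ normal s, (0 < size s)%N & C = conj_class (comm_elt k s)].
Proof.
split=> [[_ [_ [[y ->] [x ->] ij ->]]]|[s [Es s0 ->]]]; last first.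
  exists (ga ^ (ab_prod s)^-1)%g, ga; split; [by exists (ab_prod s)^-1%g|by exists 1%g; rewrite conjg1| |].
  - move=> e; apply: (comm_elt_neq1 Es s0).
    rewrite comm_eltE; move: e; rewrite conjgE invgK.
    by move=> e; rewrite -ga_sq -[X in _ = (X * _)%g]e !mulgA.
  - by rewrite comm_eltE conjgE invgK !mulgA.
(* Conjugating the second involution to a turns the first into u a u^-1 with u = x y^-1. In the
   normal form of u the trailing power of a cancels and the leading one is a further conjugation. *)
have [b [b' [s [Es uE]]]] := normal_formP (x * y^-1)%g.
have ijE : (ga ^ y * ga ^ x = comm_elt k s ^ ((ga ^+ b) * x))%g.
  have -> : (ga ^ y = (ga ^ (x * y^-1)^-1) ^ x)%g.
    by rewrite -conjgM invgM invgK -mulgA mulVg mulg1.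
  rewrite -conjMg conjgM uE; congr (_ ^ x)%g.
  rewrite comm_eltE !conjgE invgK.
  have gab (c : bool) : ((ga ^+ c)^-1 = ga ^+ c :> Z2free k)%g.
    by case: c; rewrite /= ?gaV ?invg1.
  rewrite !invgM !gab !mulgA.
  have -> : (ga ^+ b * ab_prod s * ga ^+ b' * ga * ga ^+ b' = ga ^+ b * ab_prod s * ga)%g.
    by case: (b'); rewrite /= ?mulg1 // -!mulgA ga_sq mulg1.
  by case: (b); rewrite /= ?mulg1 ?mul1g // -!mulgA.
exists s; split=> //; last by rewrite ijE conj_classJ.
rewrite lt0n size_eq0; apply/eqP => s0; apply: ij.
move: ijE; rewrite s0 /comm_elt /= conj1g => ijE.
rewrite -[RHS]mul1g -ijE -mulgA.
by rewrite -conjMg ga_sq conj1g mulg1.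
Qed.

Lemma reciprocal_setE t : reciprocal_set k (2 * t) =
  [set conj_class (comm_elt k s) | s in
    [set s : seq int | [/\ normal s, (0 < size s)%N & wlen s = t]]]%classic.
Proof.
apply/seteqP; split=> [C [/reciprocal_geodesicP[s [Es s0 ->]]]|_ [s [Es s0 st] <-]].
  rewrite class_length_comm_elt // => st; exists s => //; split=> //; lia.
split; last by rewrite class_length_comm_elt // st.
by apply/reciprocal_geodesicP; exists s.
Qed.

(** An n-th root commutes with [comm_elt s], so it shifts the sequence by a period e with n e =
    [2 * size s]. Aperiodicity makes e a multiple of [2 * size s], which forces n = 1. *)
Lemma aperiodic_primitive s g : normal s -> (0 < size s)%N -> aperiodic A s ->
  conj_class (comm_elt k s) g -> primitive_elt g.
Proof.
move=> Es s0 ap [y ->] [h [n [_ n2 hn]]].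
pose w := (h ^ y^-1)%g.
have wn : comm_elt k s = (w ^+ n)%g by rewrite /w -conjXg -hn conjgK.
have cw : (w * comm_elt k s = comm_elt k s * w)%g.
  by rewrite wn -expgS -expgSr.
have [_ [e [we Y]]] := conj_comm_elt Es Es s0 s0 cw.
have rs := end_of_reduced Es s0.
have wm m : act (fun _ : A => 0) (w ^+ m)%g (end_of A s, 0) = (end_of A s, m%:Z * e).
  elim: m => [|m IH]; first by rewrite act1 // mul0r.
  rewrite expgSr actM // we -[e]add0r.
  have := act_shift (fun _ : A => 0) (w ^+ m)%g (end_of A s, 0) e; rewrite /= => ->.
  by rewrite IH /=; congr pair; rewrite intS; ring.
have := wm n; rewrite -wn act_comm_elt // flen0_palindrome => -[ne].
have /dvdzP[q eq] := ap e Y.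
have N0 : (2 * size s)%:Z != 0 by lia.
have /(mulIf N0) nq : (n%:Z * q) * (2 * size s)%:Z = 1 * (2 * size s)%:Z.
  by rewrite mul1r -mulrA -eq -ne add0r.
by have /eqP := congr1 absz nq; rewrite abszM muln_eq1 => /andP[/eqP /= n1 _]; rewrite n1 in n2.
Qed.

Lemma conj_class_inj s s' : normal s -> normal s' -> (0 < size s)%N -> (0 < size s')%N ->
    aperiodic A s -> conj_class (comm_elt k s) = conj_class (comm_elt k s') ->
  s' = s \/ s' = refl_seq A s.
Proof.
move=> Es Es' s0 s0' ap e.
have : conj_class (comm_elt k s') (comm_elt k s) by rewrite -e; exists 1%g; rewrite conjg1.
case=> u uE; have us : (u * comm_elt k s = comm_elt k s' * u)%g.
  by rewrite uE conjgE mulVKg.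
have [ss [d [_ Y]]] := conj_comm_elt Es Es' s0 s0' us.
exact: reflect_cases Y ap.
Qed.

Lemma wlen_refl s : normal s -> wlen (refl_seq A s) = wlen s.
Proof.
rewrite /wlen /refl_seq big_rev big_map; elim: s => [|z s IH]; first by rewrite !big_nil.
case/andP=> /andP[_ /eqP zz] /IH; rewrite !big_cons => ->.
by rewrite exp_repN zz.
Qed.

(** The identity leaves the level unchanged, so the two sequences agree with shift 0. *)
Lemma comm_elt_inj s s' : normal s -> normal s' -> (0 < size s)%N -> (0 < size s')%N ->
  comm_elt k s = comm_elt k s' -> s = s'.
Proof.
move=> Es Es' s0 s0' e.
have us : (1 * comm_elt k s = comm_elt k s' * 1)%g by rewrite e mul1g mulg1.
have [ss [d []]] := conj_comm_elt Es Es' s0 s0' us.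
have rs := end_of_reduced Es s0; rewrite act1 //.
move=> [_ <-] Y; apply: (biinf_inj Es Es' ss) => i _; by rewrite -Y addr0.
Qed.

End Lengths.

(** * Periodic words *)

Section Periodic.
Variables (k : option nat) (A : exponent_group k).
Implicit Types (s : seq int) (z : int).

Local Notation phi z := (exp1 A *~ z).
Local Notation normal := (all (normal_exp A)).
Local Notation biinf := (@biinf k A).

(* By sign symmetry of the window of length d, a sequence with such a period is
   determined by d./2 of its entries and, for d odd, a middle entry of order 2. *)
Definition short_period s (d : nat) :=
  [/\ (0 < d)%N, (d <= size s)%N & forall i, biinf s (i + d%:Z) = biinf s i].

Lemma period_mul s d (q : int) : (forall i, biinf s (i + d) = biinf s i) ->
  forall i, biinf s (i + q * d) = biinf s i.
Proof.
move=> per; elim: q => [|n IH|n IH] i; first by rewrite mul0r addr0.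
- by rewrite intS mulrDl mul1r addrA IH per.
- by rewrite -[LHS]per -[RHS]IH; congr biinf; rewrite intS; ring.
Qed.

(** By Bezout, the gcd of [2 * size s] and a period that it does not divide is again a period. Being
    a proper divisor, it is at most half of [2 * size s]. *)
Lemma not_aperiodic s : (0 < size s)%N -> ~ aperiodic A s -> exists d, short_period s d.
Proof.
move=> s0 /existsNP[d /not_implyP[per /negP ndvd]].
set N := (2 * size s)%:Z in ndvd.
pose g := gcdz d N; have [u [v uv]] := Bezoutz d N.
have perg i : biinf s (i + g) = biinf s i.
  by rewrite /g -uv addrA biinf_period period_mul.
have gN : (g %| N)%Z by apply: dvdz_gcdr.
have gd : (g %| d)%Z by apply: dvdz_gcdl.
have g0 : 0 <= g by [].
move: gN => /dvdzP[q qE].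
exists `|g|%N; split.
- rewrite absz_gt0; apply/eqP => gz; move: qE; rewrite gz mulr0 /N; lia.
- have q1 : q != 1.
    by apply: contraNneq ndvd => q1; rewrite qE q1 mul1r.
  suff : 2 * g <= N by rewrite /N; lia.
  have N0 : 0 < N by rewrite /N; lia.
  have gp : 0 < g by rewrite lt0r g0 andbT; apply: contraTneq N0 => gz; rewrite qE gz mulr0.
  rewrite qE ler_pM2r //; have : 0 < q by move: N0; rewrite qE pmulr_lgt0.
  by move: q1; lia.
- by move=> i; rewrite gez0_abs.
Qed.

Lemma short_period_reflect s d i : (0 < size s)%N -> short_period s d ->
  biinf s (d%:Z - 1 - i) = - biinf s i.
Proof.
move=> s0 [_ _ per]; rewrite -biinf_anti // -[RHS]per; congr biinf; ring.
Qed.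

Lemma biinf_neq0 s i : normal s -> (0 < size s)%N -> biinf s i != 0.
Proof.
move=> Es s0; have /allP := nz_palindrome Es; apply; apply: mem_nth.
rewrite size_palindrome -ltz_nat gez0_abs ?modz_ge0 ?ltz_pmod //; lia.
Qed.

(** The reflection of the window of length d negates its entries, so the last [d./2] letters weigh
    as much as the first, and the two blocks are disjoint. *)
Lemma short_period_half s d : normal s -> (0 < size s)%N -> short_period s d ->
  (2 * wlen (take d./2 s) <= wlen s)%N.
Proof.
move=> Es s0 sp; have [d0 dn _] := sp.
have [h -> hd] : exists2 h, d./2 = h & (h + h <= d)%N.
  by exists d./2; rewrite // -[leqRHS]odd_double_half addnn leq_addl.
have refl_half : drop (d - h) (take d s) = refl_seq A (take h s).
  apply: (@eq_from_nth int 0).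
    by rewrite size_refl size_drop !size_takel; lia.
  rewrite size_drop size_takel // => i ih.
  rewrite nth_drop nth_take; last by lia.
  rewrite /refl_seq nth_rev size_map size_takel; try by lia.
  rewrite (nth_map (0 : int)) ?size_takel; try by lia.
  rewrite nth_take; last by lia.
  rewrite -biinf_small; last by lia.
  rewrite -(short_period_reflect _ s0 sp).
  have -> : d%:Z - 1 - (h - i.+1)%N%:Z = (d - h + i)%N%:Z by lia.
  have lt : (d - h + i < size s)%N by lia.
  rewrite biinf_small //.
  by have /allP/(_ _ (mem_nth (0 : int) lt))/andP[_ /eqP->] := Es.
rewrite -{2}(cat_take_drop d s) wlen_cat -{1}(cat_take_drop (d - h) (take d s)).
rewrite wlen_cat refl_half wlen_refl; last first.
  by apply/allP => z /mem_take; move/allP: Es; apply.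
rewrite take_takel; last by lia.
rewrite -(cat_take_drop h (take (d - h) s)) wlen_cat take_takel; last by lia.
lia.
Qed.

Lemma short_period_inj s s' d d' : normal s -> normal s' ->
    (0 < size s)%N -> (0 < size s')%N -> wlen s = wlen s' ->
    short_period s d -> short_period s' d' -> odd d = odd d' ->
    take d./2 s = take d'./2 s' ->
  s = s'.
Proof.
move=> Es Es' s0 s0' ww sp sp' odd_eq take_eq.
have [d0 dn per] := sp; have [d0' dn' per'] := sp'.
have dd : d = d'.
  have := congr1 size take_eq; rewrite !size_takel; lia.
move: d' dd {odd_eq d0'} sp' dn' per' take_eq => _ <- sp' dn' per' take_eq.
have half i : (i < d./2)%N -> biinf s i%:Z = biinf s' i%:Z.
  move=> ih; rewrite !biinf_small; try by lia.
  by congr (_ *~ _); rewrite -(nth_take _ ih) take_eq nth_take.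
have window i : (i < d)%N -> biinf s i%:Z = biinf s' i%:Z.
  move=> lt; case: (ltnP i d./2) => [/half//|le].
  have iE : d%:Z - 1 - (d - i.+1)%N%:Z = i%:Z by lia.
  case: (ltnP (d - i.+1) d./2) => [/half e|le2].
    by rewrite -iE !short_period_reflect // e.
  (* The middle entry is its own negative, and at most one nonzero exponent has this property. *)
  have mid : d%:Z - 1 - i%:Z = i%:Z.
    by have := odd_double_half d; lia.
  apply: exp_2torsion; try exact: biinf_neq0.
    by rewrite -(short_period_reflect i s0 sp) mid.
  by rewrite -(short_period_reflect i s0' sp') mid.
have all_eq (i : nat) : biinf s i%:Z = biinf s' i%:Z.
  have iE : i%:Z = (i %% d)%N%:Z + (i %/ d)%N%:Z * d%:Z by have := divn_eq i d; lia.
  by rewrite iE !period_mul // window // ltn_mod.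
(* Equal sequences may still be cut at different lengths; the shorter word is then a prefix of the
   longer, and equal weight makes them coincide. *)
have wlog_le t t' : normal t -> normal t' -> wlen t = wlen t' -> (size t <= size t')%N ->
    (forall i : nat, biinf t i%:Z = biinf t' i%:Z) -> t = t'.
  move=> /allP Et /allP Et' wt st e.
  have tE : t = take (size t) t'.
    apply: (@eq_from_nth int 0) => [|i it]; first by rewrite size_takel.
    rewrite nth_take //; have := e i; rewrite !biinf_small //; last exact: leq_trans st.
    by apply: normal_exp_inj; [apply: Et|apply: Et']; apply: mem_nth => //; apply: leq_trans st.
  have : wlen (drop (size t) t') = 0%N.
    by move: wt; rewrite -{1}(cat_take_drop (size t) t') wlen_cat -tE; lia.
  case dE : (drop (size t) t') => [|z u]; last by rewrite /wlen big_cons.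
  by rewrite -(cat_take_drop (size t) t') -tE dE cats0.
case/orP: (leq_total (size s) (size s')) => le; first exact: wlog_le.
by apply/esym/wlog_le.
Qed.

End Periodic.

(** * Counting words and conjugacy classes *)

Lemma card_set_seq (T : choiceType) (P : set T) (s : seq T) :
  (forall x, P x <-> x \in s) -> card_set P = size (undup s).
Proof.
move=> Ps; rewrite -card_fseq /card_set.
suff -> : P = [set` [fset x in s]%fset]%classic by rewrite set_fsetK.
by apply/seteqP; split=> x /=; rewrite inE /= => /Ps.
Qed.

(** Each fibre is {x, i x}, so every value of f has multiplicity 2 in [map f s]. *)
Lemma size_undup_map_2to1 (T U : eqType) (f : T -> U) (i : T -> T) (s : seq T) :
    uniq s -> (forall x, x \in s -> i x \in s /\ i x <> x) ->
    (forall x, x \in s -> f (i x) = f x) ->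
    (forall x y, x \in s -> y \in s -> f x = f y -> y = x \/ y = i x) ->
  (2 * size (undup (map f s)))%N = size s.
Proof.
move=> us si fi finj.
rewrite -(size_map f s) -(perm_size (perm_count_undup (map f s))) size_flatten.
rewrite /shape -map_comp mulnC -sum1_size big_distrl /= sumnE big_map.
rewrite big_seq [RHS]big_seq; apply: eq_bigr => c; rewrite mem_undup => /mapP[x xs ->].
rewrite mul1n /= size_nseq count_map -size_filter.
have [ixs ixx] := si x xs.
suff /perm_size -> : perm_eq [seq y <- s | preim f (pred1 (f x)) y] [:: x; i x] by [].
apply: uniq_perm; first exact: filter_uniq.
  by rewrite /= inE andbT eq_sym; apply/eqP.
move=> y; rewrite mem_filter !inE /=; apply/idP/idP.
  by case/andP=> /eqP e ys; case: (finj x y xs ys (esym e)) => ->; rewrite eqxx ?orbT.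
by case/orP=> /eqP ->; rewrite ?fi ?eqxx.
Qed.

(** * Enumeration of the words of given weight *)

Section Enumeration.
Variable E : pred int.
Hypothesis E0 : ~~ E 0.

Definition letters (t : nat) : seq int :=
  [seq l <- flatten [seq [:: j%:Z; - j%:Z] | j <- iota 1 t] | E l].

(* n is fuel: the value is the intended one when t <= n. *)
Fixpoint words_rec (n t : nat) : seq (seq int) :=
  match t, n with
  | 0, _ => [:: [::]]
  | _.+1, 0 => [::]
  | t'.+1, n'.+1 => [seq l :: s | l <- letters t', s <- words_rec n' (t' - `|l|%N)]
  end.

Definition words t := words_rec t t.

Definition num_words t := size (words t).

Lemma mem_letters t l : (l \in letters t) = E l && (`|l| <= t)%N.
Proof.
rewrite mem_filter; case El: (E l) => //=.
apply/flatten_mapP/idP => [[j]|lt].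
  by rewrite mem_iota !inE => jt /orP[]/eqP->; lia.
exists `|l|%N; last by rewrite !inE; lia.
have : l != 0 by apply: contraTneq El => ->.
by rewrite mem_iota; lia.
Qed.

Lemma uniq_letters t : uniq (letters t).
Proof.
apply: filter_uniq; suff H m : uniq (flatten [seq [:: j%:Z; - j%:Z] | j <- iota m.+1 t]).
  exact: (H 0%N).
elim: t m => //= t IH m; rewrite IH inE andbT negb_or -andbA.
apply/and3P; split; first by lia.
  by apply/flatten_mapP => -[j]; rewrite mem_iota !inE; lia.
by apply/flatten_mapP => -[j]; rewrite mem_iota !inE; lia.
Qed.

Lemma mem_words_rec n t s : (t <= n)%N ->
  (s \in words_rec n t) = all E s && (wlen s == t).
Proof.
elim: n t s => [|n IH] [|t] s // tn; rewrite ?inE.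
- by case: s => [|z s]; rewrite /wlen ?big_nil ?big_cons // andbF.
- by case: s => [|z s]; rewrite /wlen ?big_nil ?big_cons // andbF.
apply/allpairsPdep/idP => [[l [u [lt us ->]]]|].
  move: lt us; rewrite mem_letters => /andP[El lt]; rewrite IH; last by lia.
  by rewrite /wlen big_cons /= El => /andP[-> /eqP->] /=; lia.
case: s => [|l s]; first by rewrite /wlen big_nil.
rewrite /wlen big_cons -/(wlen s) /= => /andP[/andP[El Es] /eqP ls].
exists l, s; split=> //; first by rewrite mem_letters El; lia.
by rewrite IH ?Es; lia.
Qed.

Lemma uniq_words_rec n t : uniq (words_rec n t).
Proof.
elim: n t => [|n IH] [|t] //=; apply: allpairs_uniq_dep => //.
  exact: uniq_letters.
by move=> [l u] [l' u'] _ _ /= [-> ->].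
Qed.

Lemma mem_words t s : (s \in words t) = all E s && (wlen s == t).
Proof. exact: mem_words_rec. Qed.

Lemma uniq_words t : uniq (words t).
Proof. exact: uniq_words_rec. Qed.

Lemma num_words_rec n t : (t <= n)%N -> size (words_rec n t) = num_words t.
Proof.
move=> tn; apply/perm_size/uniq_perm; try exact: uniq_words_rec.
by move=> s; rewrite mem_words mem_words_rec.
Qed.

(** Words are sorted by the absolute value j of the first exponent, which together with its a uses
    up weight j + 1. *)
Lemma num_wordsS t :
  num_words t.+1 = (\sum_(1 <= j < t.+1) (E j%:Z + E (- j%:Z)%R) * num_words (t - j))%N.
Proof.
rewrite {1}/num_words /words /= size_allpairs_dep sumnE big_map.
rewrite /letters big_filter big_flatten /= big_map /index_iota subn1 /=.
rewrite big_seq [RHS]big_seq; apply: eq_bigr => j; rewrite mem_iota => jt.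
rewrite big_mkcond !big_cons big_nil /= addn0 abszN !num_words_rec ?leq_subr //=.
by case: (E _); case: (E _); rewrite /= ?mul1n ?mul0n ?addn0 // mul2n addnn.
Qed.

End Enumeration.

Section Counting.
Variables (k : option nat) (A : exponent_group k).
Local Notation normal := (all (normal_exp A)).
Local Notation words := (words (normal_exp A)).
Local Notation num_words := (num_words (normal_exp A)).

Lemma normal_exp0 : ~~ normal_exp A 0.
Proof. by rewrite /normal_exp eqxx. Qed.

Definition conj_comm (s : seq int) : set (Z2free k) := conj_class (comm_elt k s).

Lemma mem_wordsP t s : (0 < t)%N ->
  s \in words t -> [/\ normal s, (0 < size s)%N & wlen s = t].
Proof.
move=> t0; rewrite (mem_words normal_exp0) => /andP[Es /eqP st]; split=> //.
by case: s st {Es} t0 => // <-; rewrite /wlen big_nil.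
Qed.

Lemma reciprocal_set_words t C : (0 < t)%N ->
  reciprocal_set k (2 * t) C <-> C \in map conj_comm (words t).
Proof.
move=> t0; rewrite (reciprocal_setE A); split.
  case=> s [Es s0 st] <-; apply: map_f; rewrite (mem_words normal_exp0) Es st eqxx //.
by case/mapP=> s /(mem_wordsP t0)[Es s0 st] ->; exists s.
Qed.

(** A periodic word is encoded by the parity of a short period and the first half of its window. The
    half has weight at most t/2, and the parity accounts for the factor 2. *)
Lemma periodic_words_le t : (0 < t)%N ->
  (size [seq s <- words t | ~~ `[< aperiodic A s >]] <=
   2 * \sum_(0 <= j < (t./2).+1) num_words j)%N.
Proof.
move=> t0; set B := [seq s <- _ | _].
have BP s : s \in B -> [/\ normal s, (0 < size s)%N, wlen s = t &
    exists d, short_period A s d].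
  rewrite mem_filter => /andP[/asboolPn ap /(mem_wordsP t0)[Es s0 st]]; split=> //.
  exact: not_aperiodic.
pose per s := xget 0%N [set d | short_period A s d]%classic.
have perP s : s \in B -> short_period A s (per s).
  by case/BP => _ _ _ [d ds]; apply: (xgetI _ ds).
pose code s := (odd (per s), take (per s)./2 s).
have code_inj : {in B &, injective code}.
  move=> s s' Bs Bs' [eo et]; have [Es s0 st _] := BP s Bs; have [Es' s0' st' _] := BP s' Bs'.
  by apply: (short_period_inj Es Es' s0 s0' _ (perP s Bs) (perP s' Bs') eo et); rewrite st.
pose half := flatten [seq words j | j <- index_iota 0 (t./2).+1].
pose target := [seq (b, u) | b <- [:: true; false], u <- half].
have sz : size target = (2 * \sum_(0 <= j < (t./2).+1) num_words j)%N.
  by rewrite size_allpairs size_flatten /shape -map_comp sumnE big_map.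
rewrite -sz -(size_map code); apply: uniq_leq_size.
  by rewrite map_inj_in_uniq // filter_uniq // uniq_words // normal_exp0.
move=> _ /mapP[s sB ->]; have [Es s0 st _] := BP s sB.
apply: allpairs_f; first by case: (odd _).
apply/flatten_mapP; exists (wlen (take (per s)./2 s)).
  rewrite mem_index_iota /= ltnS; have := short_period_half Es s0 (perP s sB).
  by rewrite st; lia.
rewrite (mem_words normal_exp0) eqxx andbT.
by apply/allP => z /mem_take; move/allP: Es; apply.
Qed.

(** The aperiodic words P give exactly |P|/2 classes, all primitive, and every other class comes
    from one of at most [nb] remaining words. Hence r and r' both lie between |P|/2 and |P|/2 +
    [nb]. *)
Lemma reciprocal_count t (r := card_set (reciprocal_set k (2 * t)))
    (r' := card_set (primitive_reciprocal_set k (2 * t)))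
    (nb := (2 * \sum_(0 <= j < (t./2).+1) num_words j)%N) : (0 < t)%N ->
  [/\ (r' <= r)%N, (2 * r <= num_words t + nb)%N & (num_words t <= 2 * r' + nb)%N].
Proof.
move=> t0; set L := map conj_comm (words t).
have rE : r = size (undup L) by apply: card_set_seq => C; apply: reciprocal_set_words.
pose prim (C : set (Z2free k)) := `[< forall g, C g -> primitive_elt g >].
have rE' : r' = size (undup [seq C <- L | prim C]).
  apply: card_set_seq => C; rewrite mem_filter; split.
    by case=> /(reciprocal_set_words _ t0) CL /asboolP pC; apply/andP.
  by case/andP=> /asboolP pC /(reciprocal_set_words _ t0).
pose aper s := `[< aperiodic A s >].
pose P := [seq s <- words t | aper s]; pose B := [seq s <- words t | ~~ aper s].
have PB : (size P + size B)%N = num_words t.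
  by rewrite !size_filter /num_words -(count_predC aper (words t)).
have Bnb : (size B <= nb)%N by apply: periodic_words_le.
have PP s : s \in P -> [/\ aperiodic A s, normal s, (0 < size s)%N & wlen s = t].
  by rewrite mem_filter => /andP[/asboolP ap /(mem_wordsP t0)[]].
have P2 : (2 * size (undup (map conj_comm P)))%N = size P.
  apply: (size_undup_map_2to1 (i := refl_seq A)).
  - by rewrite filter_uniq // uniq_words // normal_exp0.
  - move=> s /PP[ap Es s0 st]; split; last exact: aperiodic_refl_neq.
    rewrite mem_filter (mem_words normal_exp0) normal_refl // wlen_refl // st eqxx !andbT.
    by apply/asboolP/aperiodic_refl.
  - by move=> s _; rewrite /conj_comm comm_elt_refl conj_classJ.
  - move=> s s' /PP[ap Es s0 _] /PP[_ Es' s0' _]; exact: conj_class_inj.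
have PL C : C \in undup (map conj_comm P) -> C \in undup [seq C <- L | prim C].
  rewrite !mem_undup mem_filter => /mapP[s sP ->]; apply/andP; split.
    have [ap Es s0 _] := PP s sP.
    by apply/asboolP => g; apply: (aperiodic_primitive Es s0 ap).
  by apply: map_f; move: sP; rewrite mem_filter => /andP[].
split.
- rewrite rE rE'; apply: uniq_leq_size; first exact: undup_uniq.
  by move=> C; rewrite !mem_undup mem_filter => /andP[].
- have : (r <= size (undup (map conj_comm P) ++ map conj_comm B))%N.
    rewrite rE; apply: uniq_leq_size; first exact: undup_uniq.
    move=> C; rewrite mem_cat !mem_undup => /mapP[s sW ->].
    case ap : (aper s); [apply/orP; left|apply/orP; right];
      by apply: map_f; rewrite mem_filter ?ap.
  by rewrite size_cat size_map; lia.
- have : (size (undup (map conj_comm P)) <= r')%N.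
    by rewrite rE'; apply: uniq_leq_size; first exact: undup_uniq.
  by lia.
Qed.

End Counting.

(** * The cyclic groups of exponents *)

Definition int_exponents : exponent_group None.
Proof.
refine (@ExponentGroup None int 1 id _ _ _ _ _ _ _) => //.
- by move=> x; rewrite intz.
- by move=> x; rewrite abszN.
- by move=> x; lia.
- by move=> x y x0 _ xx; lia.
- by move=> z; rewrite intz => ->.
Defined.

Lemma normal_exp_int z : normal_exp int_exponents z = (z != 0).
Proof. by rewrite /normal_exp /= intz eqxx andbT. Qed.

Section FiniteExponents.
Variable k : nat.
Hypothesis k1 : (1 < k)%N.

(** For even k the tie at k/2 is resolved towards the positive representative, as in E_k. *)
Definition Zp_rep (x : 'Z_k) : int :=
  if (2 * x <= k)%N then (x : nat)%:Z else (x : nat)%:Z - k%:Z.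

Lemma Zp_lt (x : 'Z_k) : (x < k)%N.
Proof. by rewrite -[ltnRHS](Zp_cast k1). Qed.

Lemma Zp_repE (x : 'Z_k) : (`|Zp_rep x|%N = minn x (k - x))%N.
Proof. by rewrite /Zp_rep; have := Zp_lt x; case: ifP; lia. Qed.

Lemma val_Zp_opp (x : 'Z_k) : (- x : 'Z_k) = (if x == 0 :> nat then 0 else k - x)%N :> nat.
Proof.
have := Zp_lt x; rewrite /=; move: (nat_of_ord x) => n; rewrite (Zp_cast k1) => lt.
by case: eqP => [->|n0]; rewrite ?subn0 ?modnn // modn_small //; lia.
Qed.

Lemma val_Zp_add1 (x : 'Z_k) : (x + 1 : 'Z_k) = (if x.+1 == k then 0 else x.+1)%N :> nat.
Proof.
have := Zp_lt x; rewrite /=; move: (nat_of_ord x) => n; rewrite (Zp_cast k1) => lt.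
rewrite (modn_small k1) addn1; case: eqP => [->|ne]; first by rewrite modnn.
by rewrite modn_small //; lia.
Qed.

Lemma Zp_rep_intr (x : 'Z_k) : 1 *~ Zp_rep x = x.
Proof.
rewrite /Zp_rep; case: ifP => _; first by rewrite -pmulrn natr_Zp.
by rewrite mulrzBr -!pmulrn natr_Zp (pchar_Zp k1) subr0.
Qed.

Lemma Zp_intr_eq0 (z : int) : (1 *~ z == 0 :> 'Z_k) = (k%:Z %| z)%Z.
Proof.
have natr0 n : (n%:R == 0 :> 'Z_k) = (k %| n)%N.
  by rewrite -val_eqE /= val_Zp_nat // /dvdn.
case: z => n; first by rewrite -pmulrn natr0.
by rewrite NegzE mulrNz oppr_eq0 -pmulrn natr0 dvdzE abszN.
Qed.

Definition Zp_exponents : exponent_group (Some k).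
Proof.
refine (@ExponentGroup (Some k) 'Z_k 1 Zp_rep _ Zp_rep_intr _ _ _ _ _).
- by move=> n [<-]; apply: pchar_Zp.
- by [].
- move=> x; rewrite !Zp_repE val_Zp_opp; have := Zp_lt x; case: eqP; lia.
- move=> x; rewrite !Zp_repE val_Zp_add1; have := Zp_lt x; case: eqP; lia.
- move=> x y x0 y0 /(congr1 (@nat_of_ord _)) + /(congr1 (@nat_of_ord _)).
  rewrite !val_Zp_opp => xx yy; apply: val_inj => /=.
  have xn : (x : nat) != 0%N by rewrite -val_eqE in x0.
  have yn : (y : nat) != 0%N by rewrite -val_eqE in y0.
  move: xx yy; rewrite (negPf xn) (negPf yn) => xx yy.
  have := Zp_lt x; have := Zp_lt y; lia.
- move=> z /eqP; rewrite Zp_intr_eq0 => /dvdzP[q ->].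
  by rewrite mulrC; apply: expgz_mul_eq1; apply: gb_order.
Defined.

Lemma normal_exp_Zp z : normal_exp Zp_exponents z = in_E k z.
Proof.
rewrite /normal_exp /in_E; case: eqVneq => //= z0.
have repE (x : 'Z_k) : (- (k.-1)./2%:Z <= Zp_rep x) && (Zp_rep x <= (k./2)%:Z).
  by rewrite /Zp_rep; have := Zp_lt x; case: ifP; lia.
apply/eqP/idP => [<-//|zE].
have : (k%:Z %| z - Zp_rep (1 *~ z))%Z.
  by rewrite -Zp_intr_eq0 mulrzBr Zp_rep_intr subrr.
case/dvdzP=> q; have := repE (1 *~ z); move: (Zp_rep _) => r rE qE.
have : q = 0.
  have k0 : (0 : int) < k%:Z by lia.
  have : q * k%:Z < k%:Z /\ - k%:Z < q * k%:Z by rewrite -qE; lia.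
  by rewrite -{2}[k%:Z]mul1r -mulN1r !ltr_pM2r //; lia.
by move=> q0; move: qE; rewrite q0 mul0r; lia.
Qed.

Lemma card_N_set t : (0 < t)%N ->
  card_set (N_set k (2 * t)) = num_words (normal_exp Zp_exponents) t.
Proof.
move=> t0; have E0 := normal_exp0 Zp_exponents.
rewrite (card_set_seq (s := map (comm_elt (Some k)) (words (normal_exp Zp_exponents) t))).
  rewrite undup_id ?size_map // map_inj_in_uniq ?uniq_words //.
  move=> s s' /(mem_wordsP t0)[Es s0 _] /(mem_wordsP t0)[Es' s0' _].
  exact: (comm_elt_inj Es Es' s0 s0').
move=> g; split=> [[_ [[x [xs [Ex ->]]] gE gt]]|].
  rewrite gE -comm_elt_bb; apply: map_f; rewrite mem_words //.
  have Es : all (normal_exp Zp_exponents) (x :: xs).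
    by apply: sub_all Ex => z; rewrite normal_exp_Zp.
  rewrite Es; move: gt; rewrite gE -comm_elt_bb (word_length_comm_elt Es) //.
  by move=> /eqP; rewrite eqn_mul2l.
case/mapP=> -[|x xs] /(mem_wordsP t0)[Es s0 st] // ->.
exists (bb_elt (Some k) x xs); rewrite -comm_elt_bb (word_length_comm_elt Es) // st.
split=> //; exists x, xs; split=> //.
by apply: sub_all Es => z; rewrite normal_exp_Zp.
Qed.

End FiniteExponents.

(** * The characteristic polynomial *)

Lemma deriv_prod_XsubC (F : fieldType) n (lam : 'I_n -> F) i :
  (\prod_(j < n) ('X - (lam j)%:P))^`().[lam i] = \prod_(j < n | j != i) (lam i - lam j).
Proof.
rewrite (bigD1 i) //= derivM derivXsubC mul1r !hornerE subrr mul0r addr0 horner_prod.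
by apply: eq_bigr => j _; rewrite !hornerE.
Qed.

(* The coefficient of X^n in the Lagrange interpolation of q at the lam i. *)
Lemma sum_div_deriv (F : fieldType) n (lam : 'I_n.+1 -> F) (q : {poly F}) :
    injective lam -> (size q <= n.+1)%N ->
  \sum_i q.[lam i] / (\prod_(j < n.+1) ('X - (lam j)%:P))^`().[lam i] = q`_n.
Proof.
move=> lam_inj sq; set P := \prod_j _.
pose Pi i := \prod_(j < n.+1 | j != i) ('X - (lam j)%:P).
have sPi i : size (Pi i) = n.+1.
  rewrite /Pi -big_filter size_prod_XsubC; congr _.+1.
  by rewrite -sum1_size big_filter sum1_card cardC1 card_ord.
have Pi1 i : (Pi i)`_n = 1.
  have /monicP := monic_prod_XsubC (index_enum 'I_n.+1) (fun j => j != i) lam.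
  by rewrite lead_coefE -/(Pi i) sPi.
have Pii i : (Pi i).[lam i] = P^`().[lam i].
  by rewrite deriv_prod_XsubC horner_prod; apply: eq_bigr => j _; rewrite !hornerE.
have P0 i : P^`().[lam i] != 0.
  rewrite deriv_prod_XsubC prodf_seq_neq0; apply/allP => j _; apply/implyP => ji.
  by rewrite subr_eq0; apply: contraNneq ji => /lam_inj ->.
have Pij i j : j != i -> (Pi i).[lam j] = 0.
  by move=> ji; rewrite horner_prod (bigD1 j) //= !hornerE subrr mul0r.
pose L := \sum_i (q.[lam i] / P^`().[lam i]) *: Pi i.
suff qL : q = L.
  rewrite [in RHS]qL coef_sum; apply: eq_bigr => i _.
  by rewrite coefZ Pi1 mulr1.
apply/eqP; rewrite -subr_eq0; apply: contraT => d0.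
have sL : (size L <= n.+1)%N.
  apply: leq_trans (size_sum _ _ _) _; apply/bigmax_leqP => i _.
  by apply: leq_trans (size_scale_leq _ _) _; rewrite sPi.
have /(max_poly_roots d0) : all (root (q - L)) [seq lam i | i <- enum 'I_n.+1].
  apply/allP => _ /mapP[j _ ->]; rewrite /root !hornerE horner_sum.
  rewrite (bigD1 j) //= big1 => [|i ij]; first by rewrite !hornerE Pii divfK // subrr.
  by rewrite !hornerE Pij ?mulr0 // eq_sym.
rewrite map_inj_uniq ?enum_uniq // size_map size_enum_ord => /(_ isT).
rewrite ltnNge; case/negP; apply: leq_trans (size_polyD _ _) _.
by rewrite size_polyN geq_max sq sL.
Qed.

(** * Characteristic polynomials and their positive root *)

Section DominantRoot.
Variables (m : nat) (w : nat -> nat).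

(** The term X^m is absent because a syllable a b^x has weight at least 2. *)
Definition rec_poly (F : nzRingType) : {poly F} :=
  'X^(m.+1) - \sum_(j < m) (w j)%:R *: 'X^j.

Lemma horner_rec_poly (F : comNzRingType) (x : F) :
  (rec_poly F).[x] = x ^+ m.+1 - \sum_(j < m) (w j)%:R * x ^+ j.
Proof.
rewrite /rec_poly hornerD hornerN hornerXn horner_sum; congr (_ - _).
by apply: eq_bigr => j _; rewrite hornerZ hornerXn.
Qed.

Lemma root_rec_poly (F : comNzRingType) (x : F) :
  root (rec_poly F) x = (x ^+ m.+1 == \sum_(j < m) (w j)%:R * x ^+ j).
Proof. by rewrite /root horner_rec_poly subr_eq0. Qed.

Lemma map_rec_poly (F K : nzRingType) (f : {rmorphism F -> K}) :
  map_poly f (rec_poly F) = rec_poly K.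
Proof.
rewrite /rec_poly rmorphB /= map_polyXn rmorph_sum; congr (_ - _).
by apply: eq_bigr => j _; rewrite /= map_polyZ map_polyXn rmorph_nat.
Qed.

Lemma size_rec_poly_lt (F : nzRingType) :
  (size (\sum_(j < m) (w j)%:R *: 'X^j : {poly F})%R <= m)%N.
Proof.
apply: leq_trans (size_sum _ _ _) _; apply/bigmax_leqP => j _.
by apply: leq_trans (size_scale_leq _ _) _; rewrite size_polyXn.
Qed.

Lemma size_rec_poly (F : nzRingType) : size (rec_poly F) = m.+2.
Proof.
rewrite /rec_poly size_polyDl size_polyXn //.
by rewrite size_polyN ltnS; apply: leq_trans (size_rec_poly_lt F) _; rewrite ?leqnSn.
Qed.

Lemma monic_rec_poly (F : nzRingType) : rec_poly F \is monic.
Proof.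
rewrite monicE /rec_poly lead_coefDl ?lead_coefXn //.
by rewrite size_polyN size_polyXn ltnS; apply: leq_trans (size_rec_poly_lt F) _; rewrite ?leqnSn.
Qed.

Section Real.
Variable R : realType.
Implicit Types x y : R.
Hypothesis m2 : (2 <= m)%N.
Hypothesis w1 : (0 < w m.-1)%N.
Hypothesis w2 : (0 < w m.-2)%N.

Local Notation p := (rec_poly R).

(** Scaling x by q > 1 multiplies the leading term by q^(m+1), and each other term by at most
    q^m. *)
Lemma rec_poly_pos x y : 0 < x -> 0 <= p.[x] -> x < y -> 0 < p.[y].
Proof.
move=> x0; rewrite !horner_rec_poly subr_ge0 subr_gt0 => px xy.
have [q q1 ->] : exists2 q, 1 < q & y = q * x.
  by exists (y / x); rewrite ?divfK ?gt_eqF // ltr_pdivlMr // mul1r.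
have q0 : 0 < q by apply: lt_trans q1.
apply: (@le_lt_trans _ _ (q ^+ m * x ^+ m.+1)); last first.
  by rewrite exprMn ltr_pM2r ?exprn_gt0 // ltr_eXn2l.
apply: (@le_trans _ _ (q ^+ m * \sum_(j < m) (w j)%:R * x ^+ j)); last first.
  by rewrite ler_pM2l ?exprn_gt0.
rewrite mulr_sumr; apply: ler_sum => j _; rewrite mulrCA ler_wpM2l ?ler0n //.
by rewrite exprMn ler_pM2r ?exprn_gt0 // ler_weXn2l ?(ltW q1) ?(ltnW (ltn_ord j)).
Qed.

Lemma exists_dominant_root : exists alpha : R,
  [/\ 1 < alpha, root p alpha & forall y, 0 < y -> root p y -> y = alpha].
Proof.
(* A Cauchy bound with p(M) nonnegative, while p(1) < 0 because the coefficients sum to at least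
   2. *)
pose M : R := 1 + \sum_(j < m) (w j)%:R.
have S2 : 2 <= \sum_(j < m) (w j)%:R :> R.
  have lt1 : (m.-1 < m)%N by lia.
  have lt2 : (m.-2 < m)%N by lia.
  rewrite (bigD1 (Ordinal lt1)) //= (bigD1 (Ordinal lt2)) /=; last first.
    by rewrite -val_eqE /=; lia.
  have a1 : 1 <= (w m.-1)%:R :> R by rewrite ler1n.
  have a2 : 1 <= (w m.-2)%:R :> R by rewrite ler1n.
  have : 0 <= \sum_(i < m | (i != Ordinal lt1) && (i != Ordinal lt2)) (w i)%:R :> R.
    by apply: sumr_ge0 => i _; rewrite ler0n.
  lra.
have p1 : p.[1] < 0.
  rewrite horner_rec_poly expr1n.
  under eq_bigr do rewrite expr1n mulr1.
  lra.
have M1 : 1 <= M by rewrite /M; lra.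
have pM : 0 <= p.[M].
  rewrite horner_rec_poly subr_ge0 exprS.
  apply: (@le_trans _ _ (\sum_(j < m) (w j)%:R * M ^+ m)).
    by apply: ler_sum => j _; rewrite ler_wpM2l ?ler0n // ler_weXn2l // ltnW.
  rewrite -mulr_suml ler_wpM2r ?exprn_ge0 //; first by rewrite /M; lra.
  by rewrite /M; lra.
have [alpha /andP[a1 aM] ra] : exists2 x, 1 <= x <= M & root p x.
  by apply: poly_ivt => //; rewrite (ltW p1) pM.
have a1' : 1 < alpha.
  by rewrite lt_neqAle a1 andbT; apply: contraTneq ra => <-; rewrite /root lt_eqF.
exists alpha; split=> // y y0 ry.
have a0 : 0 < alpha by apply: lt_trans a1'.
case: (ltgtP y alpha) => // lt.
  by have := rec_poly_pos y0 _ lt; rewrite (rootP ra) (rootP ry) ltxx => /(_ (lexx _)).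
by have := rec_poly_pos a0 _ lt; rewrite (rootP ra) (rootP ry) ltxx => /(_ (lexx _)).
Qed.

(** Replacing alpha^(m+1) by the sum it equals gives alpha p'(alpha) = sum of (m + 1 - j) w_j
    alpha^j. *)
Lemma deriv_rec_poly_gt0 alpha : 0 < alpha -> root p alpha -> 0 < p^`().[alpha].
Proof.
clear w2; move=> a0; rewrite root_rec_poly => /eqP ra.
rewrite -(pmulr_rgt0 _ a0) /rec_poly derivB derivXn raddf_sum hornerD hornerN horner_sum /=.
rewrite hornerMn hornerXn mulrBr mulrnAr -exprS ra.
have -> : alpha * \sum_(j < m) ((w j)%:R *: 'X^j)^`().[alpha] =
    \sum_(j < m) (w j)%:R * alpha ^+ j *+ j.
  rewrite mulr_sumr; apply: eq_bigr => j _; rewrite derivZ derivXn hornerZ hornerMn hornerXn.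
  by case: (nat_of_ord j) => [|i]; rewrite ?mulr0n ?mulr0 //= exprS -mulrnAr; ring.
rewrite -sumrMnl -sumrB; have lt1 : (m.-1 < m)%N by lia.
rewrite (bigD1 (Ordinal lt1)) //= -mulrnBr; last by lia.
apply: ltr_wpDr.
  apply: sumr_ge0 => j _; rewrite -mulrnBr; last by have := ltn_ord j; lia.
  by rewrite mulrn_wge0 // mulr_ge0 ?ler0n // exprn_ge0 // ltW.
by rewrite pmulrn_lgt0 ?mulr_gt0 ?ltr0n ?exprn_gt0 //; lia.
Qed.

End Real.
End DominantRoot.

(** * Complex roots and the growth rate *)

Import numFieldNormedType.Exports.
Local Open Scope classical_set_scope.
Local Open Scope ring_scope.

Lemma cvg_sum_to0 (R : realType) (I : Type) (s : seq I) (P : pred I) (F : I -> R^nat) :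
  (forall i, P i -> F i @ \oo --> 0) ->
  (fun t => \sum_(i <- s | P i) F i t) @ \oo --> (0 : R).
Proof.
move=> F0; elim: s => [|i s IH].
  rewrite (_ : (fun _ => _) = cst 0); first exact: cvg_cst.
  by apply: boolp.funext => t; rewrite big_nil.
case Pi: (P i).
  rewrite (_ : (fun _ => _) = F i \+ (fun t => \sum_(j <- s | P j) F j t)).
    by have h := cvgD (F0 i Pi) IH; rewrite addr0 in h; exact: h.
  by apply: boolp.funext => t; rewrite big_cons Pi.
rewrite (_ : (fun _ => _) = (fun t => \sum_(j <- s | P j) F j t)) //.
by apply: boolp.funext => t; rewrite big_cons Pi.
Qed.

Section ComplexRoots.
Variables (R : realType) (m : nat) (w : nat -> nat).
Hypothesis m2 : (2 <= m)%N.
Hypothesis w1 : (0 < w m.-1)%N.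
Hypothesis w2 : (0 < w m.-2)%N.
Hypothesis simple_roots : forall z : R[i],
  root (rec_poly m w _) z -> (rec_poly m w _)^`().[z] != 0.

Local Notation p := (rec_poly m w R).
Local Notation pC := (rec_poly m w R[i]).

Definition cabs (z : R[i]) : R := complex.Re `|z|.

Lemma cabsE z : (cabs z)%:C%C = `|z|.
Proof. by rewrite /cabs complex.RRe_real // normr_real. Qed.

Lemma cabs_ge0 z : 0 <= cabs z.
Proof. by rewrite -complex.lecR cabsE normr_ge0. Qed.

Lemma cabs_real (x : R) : cabs x%:C%C = `|x|.
Proof.
apply: complex.complexI; rewrite cabsE.
by rewrite complex.normc_def /= expr0n addr0 sqrtr_sqr.
Qed.

(** Absolute values give p(|z|) <= 0, so |z| <= alpha. If |z| = alpha, all nonzero terms w_j z^j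
    share the direction t; comparing the exponents m - 2 and m - 1 yields z = alpha. *)
Lemma dominant_root alpha z : 0 < alpha -> root p alpha ->
  root pC z -> z != alpha%:C%C -> cabs z < alpha.
Proof.
move=> a0 ra; rewrite root_rec_poly => /eqP rz z_neq.
have sumE : (\sum_(j < m) (w j)%:R * cabs z ^+ j)%:C%C = \sum_(j < m) `|(w j)%:R * z ^+ j|.
  rewrite rmorph_sum; apply: eq_bigr => j _.
  by rewrite normrM normr_nat normrX -cabsE rmorphM rmorph_nat rmorphXn.
have zle : cabs z ^+ m.+1 <= \sum_(j < m) (w j)%:R * cabs z ^+ j.
  rewrite -complex.lecR sumE rmorphXn /= cabsE -normrX rz; exact: ler_norm_sum.
rewrite ltNge; apply/negP => le.
have {le} zE : cabs z = alpha.
  apply/eqP; rewrite eq_le le andbT leNgt; apply/negP => lt.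
  have : 0 < p.[cabs z] by apply: (rec_poly_pos a0 _ lt); rewrite (rootP ra).
  by rewrite horner_rec_poly subr_gt0 ltNge zle.
have [] : {t : R[i] | `|t| == 1 & forall j : 'I_m, true -> (w j)%:R * z ^+ j = `|(w j)%:R * z ^+ j| * t}.
  apply: normC_sum_eq; rewrite -rz normrX -cabsE -sumE zE -rmorphXn.
  by move: ra; rewrite root_rec_poly => /eqP ->.
move=> t /eqP t1 zt.
have powE j : (j < m)%N -> (0 < w j)%N -> z ^+ j = (alpha ^+ j)%:C%C * t.
  move=> jm wj; have := zt (Ordinal jm) isT; rewrite /= normrM normr_nat normrX -cabsE zE.
  by rewrite -mulrA rmorphXn /=; apply: mulfI; rewrite pnatr_eq0 -lt0n.
have t0 : t != 0 by rewrite -normr_eq0 t1 oner_eq0.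
have e1 := powE m.-1 ltac:(lia) w1; have e2 := powE m.-2 ltac:(lia) w2.
case/negP: z_neq; apply/eqP; apply: (mulIf (x := z ^+ m.-2)).
  rewrite e2 mulf_eq0 negb_or t0 andbT rmorphXn expf_eq0 negb_and.
  by apply/orP; right; rewrite fmorph_eq0 gt_eqF.
rewrite -exprS (_ : m.-2.+1 = m.-1); last by lia.
by rewrite e1 e2 mulrA -rmorphM -exprS (_ : m.-2.+1 = m.-1); last by lia.
Qed.

Lemma complex_roots alpha : root p alpha -> exists lam : 'I_m.+1 -> R[i],
  [/\ injective lam, forall i, root pC (lam i), lam ord0 = alpha%:C%C &
      pC = \prod_(i < m.+1) ('X - (lam i)%:P)].
Proof.
move=> ra.
have [rs pE] := closed_field_poly_normal pC.
rewrite (monicP (monic_rec_poly _ _ _)) scale1r in pE.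
have rsz : size rs = m.+1.
  have := size_rec_poly m w R[i]; rewrite pE size_prod_XsubC; by case.
have rs_root z : (z \in rs) = root pC z by rewrite pE root_prod_XsubC.
have urs : uniq rs.
  rewrite -separable_prod_XsubC -pE unlock /separable_poly.
  exact: Pdiv.ClosedField.root_coprimep.
have rC : alpha%:C%C \in rs.
  by rewrite rs_root -(map_rec_poly m w (real_complex R)) fmorph_root.
pose r := alpha%:C%C :: rem alpha%:C%C rs.
have prs : perm_eq rs r by apply: perm_to_rem.
have sr : size r = m.+1 by rewrite -(perm_size prs).
have ur : uniq r by rewrite -(perm_uniq prs).
exists (fun i => r`_i); split.
- by move=> i j /eqP; rewrite nth_uniq ?sr // => /eqP/val_inj.
- by move=> i; rewrite -rs_root (perm_mem prs) mem_nth ?sr.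
- by [].
- by rewrite pE (perm_big _ prs) /= (big_nth 0) sr big_mkord.
Qed.

Section Sequence.
Variable u : nat -> nat.
Hypothesis u_small : forall s, (s < m)%N -> u s = 0%N.
Hypothesis u_m : u m = 1%N.
Hypothesis u_rec : forall s, u (s + m.+1)%N = (\sum_(j < m) w j * u (s + j))%N.

(** For s <= m the sum is the coefficient of X^m in X^s, by Lagrange interpolation, which matches
    the initial values 0, ..., 0, 1. Beyond that both sides obey the same recurrence. *)
Lemma closed_form (lam : 'I_m.+1 -> R[i]) s : injective lam ->
    (forall i, root pC (lam i)) -> pC = \prod_(i < m.+1) ('X - (lam i)%:P) ->
  (u s)%:R = \sum_(i < m.+1) lam i ^+ s / pC^`().[lam i].
Proof.
move=> lam_inj rlam pE; elim/ltn_ind: s => s IH.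
case: (leqP s m) => sm.
  rewrite pE; under eq_bigr do rewrite -hornerXn.
  rewrite sum_div_deriv //; last by rewrite size_polyXn.
  rewrite coefXn; case: (ltngtP m s) sm => // [lt _|ms _]; last by rewrite -[in LHS]ms u_m.
  by rewrite u_small.
rewrite -(subnK sm) u_rec natr_sum.
transitivity (\sum_(i < m.+1) \sum_(j < m) (w j)%:R * lam i ^+ (s - m.+1 + j) / pC^`().[lam i]).
  rewrite exchange_big /=; apply: eq_bigr => j _; rewrite natrM IH.
    by rewrite mulr_sumr; apply: eq_bigr => i _; rewrite mulrA.
  by have := ltn_ord j; lia.
apply: eq_bigr => i _; rewrite -mulr_suml; congr (_ / _).
rewrite exprD; move: (rlam i); rewrite root_rec_poly => /eqP ->; rewrite mulr_sumr.
by apply: eq_bigr => j _; rewrite exprD mulrCA.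
Qed.

Lemma u_le alpha s : 0 < alpha -> root p alpha -> (u s)%:R * alpha ^+ m <= alpha ^+ s.
Proof.
move=> a0; rewrite root_rec_poly => /eqP ra; elim/ltn_ind: s => s IH.
case: (ltngtP s m) => sm.
- by rewrite u_small // mul0r exprn_ge0 // ltW.
- rewrite -(subnK sm) u_rec natr_sum mulr_suml exprD ra mulr_sumr.
  apply: ler_sum => j _; rewrite natrM -mulrA [leRHS]mulrCA -exprD.
  by rewrite ler_wpM2l ?ler0n // IH //; have := ltn_ord j; lia.
- by rewrite sm u_m mul1r.
Qed.

Lemma hecke_growth : exists alpha c : R,
  [/\ 1 < alpha, unique_pos_root p alpha,
     root_coefficient m p (fun t => u (t + m)%N) alpha c, 0 < c &
     (forall t, (u (t + m)%N)%:R <= alpha ^+ t) /\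
     growth_limit (fun t => u (t + m)%N) alpha c].
Proof.
have [alpha [a1 ra uniq_alpha]] := exists_dominant_root R m2 w1 w2.
have a0 : 0 < alpha by apply: lt_trans a1.
have [lam [lam_inj rlam lam0 pE]] := complex_roots ra.
have dpos := deriv_rec_poly_gt0 m2 w1 a0 ra.
(* The coefficient of alpha^t in the closed form at index t + m. *)
exists alpha, (alpha ^+ m / p^`().[alpha]).
pose coef i := lam i ^+ m / pC^`().[lam i].
have uE t : (u (t + m)%N)%:R = \sum_(i < m.+1) coef i * lam i ^+ t.
  rewrite (closed_form _ lam_inj rlam pE); apply: eq_bigr => i _.
  by rewrite exprD /coef [RHS]mulrC mulrA.
have coef0 : coef ord0 = (alpha ^+ m / p^`().[alpha])%:C%C.
  rewrite /coef lam0 -(map_rec_poly m w (real_complex R)) deriv_map horner_map.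
  by rewrite -rmorphXn -rmorphV ?unitfE ?gt_eqF // -rmorphM.
clearbody coef.
split=> //.
- exists lam, coef; split=> //.
  by move=> i; rewrite (map_rec_poly m w (real_complex R)).
- by rewrite divr_gt0 ?exprn_gt0.
split.
  move=> t; have := u_le (t + m) a0 ra.
  by rewrite exprD ler_pM2r ?exprn_gt0.
apply/subr_cvg0/norm_cvg0P.
pose F (i : 'I_m.+1) t := cabs (coef i) * (cabs (lam i) / alpha) ^+ t.
apply: (@squeeze_cvgr _ _ _ _ (cst 0) (fun t => \sum_(i < m.+1 | i != ord0) F i t)).
- apply: nearW => t; rewrite normr_ge0 /=.
  rewrite -complex.lecR -cabs_real cabsE rmorphB /= -coef0.
  have -> : ((u (t + m))%:R / alpha ^+ t)%:C%C - coef ord0 =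
      \sum_(i < m.+1 | i != ord0) coef i * (lam i / alpha%:C%C) ^+ t.
    rewrite rmorphM rmorph_nat uE mulr_suml (bigD1 ord0) //= lam0.
    rewrite fmorphV rmorphXn -mulrA divff ?mulr1; last first.
      by rewrite expf_neq0 // fmorph_eq0 gt_eqF.
    rewrite [LHS]addrC addKr; apply: eq_bigr => i _.
    by rewrite -mulrA exprMn exprVn.
  apply: le_trans (ler_norm_sum _ _ _) _; rewrite rmorph_sum; apply: ler_sum => i _.
  rewrite normrM normrX normrM normfV -!cabsE cabs_real gtr0_norm //.
  by rewrite -fmorphV -rmorphM -rmorphXn -rmorphM.
- exact: cvg_cst.
- apply: cvg_sum_to0 => i i0; rewrite -[0](mulr0 (cabs (coef i))).
  apply: cvgMr; apply: cvg_expr.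
  rewrite ger0_norm ?divr_ge0 ?cabs_ge0 ?(ltW a0) // ltr_pdivrMr // mul1r.
  apply: dominant_root => //; rewrite -lam0.
  by apply: contra_neq i0 => /lam_inj.
Qed.

End Sequence.
End ComplexRoots.

(** * Limits and simplicity of the roots *)

Section Limits.
Variable R : realType.
Implicit Types (alpha c : R) (N r : nat -> nat).

(** A geometric sum dominated by its last term alpha^(t/2), so the error is o(alpha^t). *)
Lemma sum_half_le alpha N t : 1 < alpha -> (forall j, (N j)%:R <= alpha ^+ j) ->
  (2 * \sum_(0 <= j < (t./2).+1) N j)%N%:R <=
  2 * alpha / (alpha - 1) * Num.sqrt alpha ^+ t.
Proof.
move=> a1 Nle; have a0 : 0 < alpha by apply: lt_trans a1.
have am1 : 0 < alpha - 1 by rewrite subr_gt0.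
have s1 : 1 <= Num.sqrt alpha by rewrite -sqrtr1 ler_wsqrtr // ltW.
apply: (@le_trans _ _ (2 * alpha / (alpha - 1) * alpha ^+ t./2)); last first.
  rewrite ler_wpM2l //; first by rewrite divr_ge0 ?mulr_ge0 ?ltW.
  rewrite -{1}(@sqr_sqrtr _ alpha) ?(ltW a0) // -exprM ler_weXn2l // mul2n.
  by rewrite -[leqRHS]odd_double_half leq_addl.
rewrite natrM natr_sum -!mulrA ler_wpM2l //.
apply: (@le_trans _ _ (\sum_(0 <= j < (t./2).+1) alpha ^+ j)); first exact: ler_sum.
rewrite mulrCA -exprS ler_pdivlMl // big_mkord -subrX1 lerBlDr lerDl //.
Qed.

Lemma growth_limit_half alpha c N r : 1 < alpha ->
    (forall j, (N j)%:R <= alpha ^+ j) -> growth_limit N alpha c ->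
    (forall t, (0 < t)%N ->
      (2 * r t <= N t + 2 * \sum_(0 <= j < (t./2).+1) N j)%N /\
      (N t <= 2 * r t + 2 * \sum_(0 <= j < (t./2).+1) N j)%N) ->
  growth_limit r alpha (c / 2).
Proof.
move=> a1 Nle Nlim rN; have a0 : 0 < alpha by apply: lt_trans a1.
set K := 2 * alpha / (alpha - 1); set b := Num.sqrt alpha.
have b0 : 0 < b by rewrite sqrtr_gt0.
have b1 : 1 < b by rewrite -sqrtr1 ltr_sqrt.
have lim0 : (fun t => K * b^-1 ^+ t) @ \oo --> (0 : R).
  rewrite -[X in _ --> X](mulr0 K); apply: cvgMr; apply: cvg_expr.
  by rewrite gtr0_norm ?invr_gt0 // invf_lt1.
have err t : K * b ^+ t / alpha ^+ t = K * b^-1 ^+ t.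
  rewrite -mulrA; congr (_ * _); rewrite -(@sqr_sqrtr _ alpha) ?(ltW a0) // -/b.
  rewrite -exprVn -exprMn; congr (_ ^+ _); rewrite expr2 invfM mulrA mulfV ?gt_eqF //.
  by rewrite mul1r.
apply: (@squeeze_cvgr _ _ _ _ (fun t => ((N t)%:R / alpha ^+ t - K * b^-1 ^+ t) / 2)
                              (fun t => ((N t)%:R / alpha ^+ t + K * b^-1 ^+ t) / 2)).
- near=> t.
  have t0 : (0 < t)%N by near: t; exact: nbhs_infty_gt.
  have at0 : 0 < alpha ^+ t by rewrite exprn_gt0.
  have [up lo'] := rN t t0; have nb := sum_half_le t a1 Nle.
  move: up lo' nb; rewrite -/K -/b -err; move: (2 * \sum_(0 <= _ < _) _)%N => nb.
  rewrite -(ler_nat R) natrD natrM => up; rewrite -(ler_nat R) natrD natrM => lo' nbK.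
  rewrite -mulrBl -mulrDl ![_ / _ / 2]mulrAC !ler_pM2r ?invr_gt0 //.
  by apply/andP; split; lra.
- by apply: cvgMl; rewrite -[c]subr0; apply: cvgB.
- by apply: cvgMl; rewrite -[c]addr0; apply: cvgD.
Unshelve. all: end_near. Qed.

End Limits.

Lemma horner_poly1 (F : nzRingType) (x : F) : (1 : {poly F}).[x] = 1.
Proof. by rewrite -polyC1 hornerC. Qed.

Lemma deriv_poly1 (F : nzRingType) : (1 : {poly F})^`() = 0.
Proof. by rewrite -polyC1 derivC. Qed.

Section Separability.
Variables (R : realType) (m : nat).
Hypothesis m2 : (2 <= m)%N.

Lemma real_root_simple (w : nat -> nat) (x : R) : (0 < w m.-1)%N -> 0 < x ->
  root (rec_poly m w R[i]) x%:C%C -> (rec_poly m w R[i])^`().[x%:C%C] != 0.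
Proof.
move=> w1 x0; rewrite -(map_rec_poly m w (real_complex R)) fmorph_root => rx.
by rewrite deriv_map horner_map fmorph_eq0 gt_eqF // deriv_rec_poly_gt0.
Qed.

Lemma rec_poly_odd_mul (F : comNzRingType) :
  ('X - 1) * rec_poly m (fun=> 2%N) F = 'X^(m.+2) - 'X^(m.+1) - 2%:R *: ('X^m - 1).
Proof.
rewrite /rec_poly -scaler_sumr mulrBr -scalerAr -subrX1 mulrBl mul1r -exprS //.
Qed.

(* By (X - 1) p = X^m (X^2 - X - 2) + 2 a double root annihilates a real
   quadratic of positive discriminant, so it is real. Positive roots are simple,
   and a negative one lies in (-1, 0) and satisfies z^m (z + 4) = 2 (m + 2). *)
Lemma odd_simple_roots (z : R[i]) : root (rec_poly m (fun=> 2%N) _) z ->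
  (rec_poly m (fun=> 2%N) _)^`().[z] != 0.
Proof.
move=> rz; apply/negP => /eqP dz.
set p := rec_poly _ _ _ in rz dz.
have powS : z ^+ m = z ^+ m.-1 * z by rewrite -exprSr prednK //; lia.
have e1 : z ^+ m * (z ^+ 2 - z - 2%:R) + 2%:R = 0.
  have <- : (('X - 1) * p).[z] = 0 by rewrite hornerM (rootP rz) mulr0.
  rewrite rec_poly_odd_mul !(hornerD, hornerN, hornerZ, hornerXn, horner_poly1) !exprS; ring.
have e2 : z ^+ m.-1 * ((m.+2)%:R * z ^+ 2 - (m.+1)%:R * z - 2%:R * m%:R) = 0.
  have <- : (('X - 1) * p)^`().[z] = 0.
    by rewrite derivM hornerD !hornerM (rootP rz) dz !mulr0 addr0.
  rewrite rec_poly_odd_mul derivB derivB derivZ derivB deriv_poly1 subr0 !derivXn.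
  by rewrite hornerD hornerN hornerD hornerN hornerZ !hornerMn !hornerXn !succnK !exprS powS; ring.
have z0 : z != 0.
  apply/eqP => z0; move: e1; rewrite z0 expr0n (_ : m == 0%N = false) ?mul0r ?add0r; last by lia.
  by move/eqP; rewrite pnatr_eq0.
have {e2} quad : (m.+2)%:R * z ^+ 2 - (m.+1)%:R * z - 2%:R * m%:R = 0.
  by apply: (mulfI (expf_neq0 m.-1 z0)); rewrite mulr0.
(* The discriminant of the quadratic [quad]. *)
pose D : R := (m.+1)%:R ^+ 2 + 8%:R * m%:R * (m.+2)%:R.
have D0 : 0 <= D by rewrite addr_ge0 ?mulr_ge0 ?ler0n // exprn_ge0.
have [x zE] : exists x : R, z = x%:C%C.
  have : (2%:R * (m.+2)%:R * z - (m.+1)%:R) ^+ 2 = ((Num.sqrt D)%:C%C) ^+ 2.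
    rewrite -rmorphXn /= sqr_sqrtr // rmorphD rmorphXn !rmorphM !rmorph_nat.
    apply/eqP; rewrite -subr_eq0.
    have -> : (2%:R * (m.+2)%:R * z - (m.+1)%:R) ^+ 2 - ((m.+1)%:R ^+ 2 + 8%:R * m%:R * (m.+2)%:R) =
      4%:R * (m.+2)%:R * ((m.+2)%:R * z ^+ 2 - (m.+1)%:R * z - 2%:R * m%:R) by ring.
    by rewrite quad mulr0.
  have nz : 2%:R * (m.+2)%:R != 0 :> R[i] by rewrite mulf_neq0 ?pnatr_eq0.
  move/eqP; rewrite eqf_sqr => /orP[]/eqP h.
    exists ((Num.sqrt D + (m.+1)%:R) / (2%:R * (m.+2)%:R)).
    rewrite rmorphM fmorphV rmorphD rmorphM !rmorph_nat /= -h subrK mulrC mulKf //.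
  exists ((- Num.sqrt D + (m.+1)%:R) / (2%:R * (m.+2)%:R)).
  by rewrite rmorphM fmorphV rmorphD rmorphN rmorphM !rmorph_nat /= -h subrK mulrC mulKf.
have quadR : (m.+2)%:R * x ^+ 2 - (m.+1)%:R * x - 2%:R * m%:R = 0.
  move: quad; rewrite zE -!(rmorph_nat (real_complex R)) -rmorphXn -!rmorphM -!rmorphB.
  by move/eqP; rewrite fmorph_eq0 => /eqP.
have e1R : x ^+ m * (x ^+ 2 - x - 2%:R) + 2%:R = 0.
  move: e1; rewrite zE -!(rmorph_nat (real_complex R)) -!rmorphXn -!rmorphB -rmorphM -rmorphD.
  by move/eqP; rewrite fmorph_eq0 => /eqP.
case: (ltP 0 x) => x0.
  by have := real_root_simple (w := fun=> 2%N) isT x0; rewrite -zE dz eqxx => /(_ rz).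
have mR : 2%:R <= m%:R :> R by rewrite ler_nat.
have M2 : (m.+2)%:R = m%:R + 2%:R :> R by rewrite -natrD addn2.
have M1 : (m.+1)%:R = m%:R + 1 :> R by rewrite -natr1.
have x1 : - 1 < x.
  (* With y = -1 - x the quadratic reads 3 + (3m + 5) y + (m + 2) y^2, which is positive for y >=
     0. *)
  rewrite ltNge; apply/negP => xle; have y0 : 0 <= - 1 - x by lra.
  have M0 : 0 <= m%:R :> R by rewrite ler0n.
  have h1 := mulr_ge0 M0 y0; have h2 := mulr_ge0 h1 y0; have h3 := mulr_ge0 y0 y0.
  by move: quadR; rewrite M1 M2; lra.
have xm : x ^+ m * (x + 4%:R) = 2%:R * (m.+2)%:R.
  move: quadR e1R; rewrite M1 M2; move: (x ^+ m) (m%:R : R) => X M q1 q2.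
  have -> : X * (x + 4%:R) = X * ((M + 2%:R) * x ^+ 2 - (M + 1) * x - 2%:R * M) -
      (M + 2%:R) * (X * (x ^+ 2 - x - 2%:R) + 2%:R) + 2%:R * (M + 2%:R) by ring.
  by rewrite q1 q2 !mulr0 subr0 add0r.
(* Here -1 < x <= 0, whereas the value 2 (m + 2) is at least 8. *)
have : `|x ^+ m * (x + 4%:R)| <= 4%:R.
  rewrite normrM normrX -[leRHS]mul1r ler_pM //.
  - by rewrite exprn_ile1 // ler_norml; lra.
  - by rewrite ger0_norm; lra.
by rewrite xm ger0_norm ?mulr_ge0 ?ler0n // M2; lra.
Qed.

Lemma rec_poly_even_mul (F : comNzRingType) :
  ('X - 1) * rec_poly m (fun j => if j == 0%N then 1%N else 2%N) F =
  ('X + 1) * ('X^(m.+1) - 2%:R *: 'X^m + 1).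
Proof.
have -> : rec_poly m (fun j => if j == 0%N then 1%N else 2%N) F = rec_poly m (fun=> 2%N) F + 1.
  have lt0 : (0 < m)%N by lia.
  have S : \sum_(j < m) 2%:R *: 'X^j =
      \sum_(j < m) (if val j == 0%N then 1%N else 2%N)%:R *: 'X^j + 1 :> {poly F}.
    rewrite (bigD1 (Ordinal lt0)) //= [in RHS](bigD1 (Ordinal lt0)) //=.
    rewrite scale1r expr0 scaler_nat mulr2n [RHS]addrAC; congr (_ + _).
    by apply: eq_bigr => j j0; rewrite ifN.
  by rewrite /rec_poly S opprD addrA subrK.
rewrite mulrDr rec_poly_odd_mul mulr1 scalerBr mulrDl mulrDr mulrBr -!exprS mulr1 mul1r.
rewrite -scalerAr -exprS !scaler_nat; ring.
Qed.

(* By (X - 1) p = (X + 1) (X^(m+1) - 2 X^m + 1) a double root other than -1 is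
   2m / (m+1), but positive roots are simple. *)
Lemma even_simple_roots (z : R[i]) (w := fun j => if j == 0%N then 1%N else 2%N) :
  root (rec_poly m w _) z -> (rec_poly m w _)^`().[z] != 0.
Proof.
move=> rz; apply/negP => /eqP dz.
set p := rec_poly _ _ _ in rz dz.
have powS : z ^+ m = z ^+ m.-1 * z by rewrite -exprSr prednK //; lia.
pose r : {poly R[i]} := 'X^(m.+1) - 2%:R *: 'X^m + 1.
have rE : r.[z] = z ^+ m * (z - 2%:R) + 1.
  by rewrite !(hornerD, hornerN, hornerZ, hornerXn, horner_poly1) exprS; ring.
have drE : r^`().[z] = z ^+ m.-1 * ((m.+1)%:R * z - 2%:R * m%:R).
  rewrite derivD derivB derivZ deriv_poly1 addr0 !derivXn.
  by rewrite hornerD hornerN hornerZ !hornerMn !hornerXn !succnK powS; ring.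
have e1 : (z + 1) * r.[z] = 0.
  have <- : (('X - 1) * p).[z] = 0 by rewrite hornerM (rootP rz) mulr0.
  by rewrite rec_poly_even_mul [RHS]hornerM -/r [('X + 1).[z]]hornerD hornerX horner_poly1.
have e2 : r.[z] + (z + 1) * r^`().[z] = 0.
  have <- : (('X - 1) * p)^`().[z] = 0.
    by rewrite derivM hornerD !hornerM (rootP rz) dz !mulr0 addr0.
  rewrite rec_poly_even_mul -/r derivM [('X + 1)^`()]derivD derivX deriv_poly1 addr0 mul1r.
  by rewrite [RHS]hornerD [(_ * _).[z]]hornerM [('X + 1).[z]]hornerD hornerX horner_poly1.
(* The root -1 of the factor X + 1 is simple since r(-1) = 1 - 3 (-1)^m is 4 or -2. *)
case: (eqVneq (z + 1) 0) => [h|z1].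
  have zN1 : z = - 1 by apply/eqP; rewrite -addr_eq0 h.
  move: e2; rewrite h mul0r addr0 rE zN1 -signr_odd; case: (odd m); rewrite ?expr1 ?expr0 => /eqP.
    by rewrite (_ : _ + 1 = 4%:R) ?pnatr_eq0 //; ring.
  by rewrite (_ : _ + 1 = - 2%:R) ?oppr_eq0 ?pnatr_eq0 //; ring.
have r0 : r.[z] = 0 by apply: (mulfI z1); rewrite mulr0.
have z0 : z != 0.
  apply/eqP => z0; move: r0; rewrite rE z0 expr0n (_ : m == 0%N = false) ?mul0r ?add0r; last by lia.
  by move/eqP; rewrite oner_eq0.
have zE : z = ((2%:R * m%:R) / (m.+1)%:R)%:C%C.
  have : (m.+1)%:R * z - 2%:R * m%:R = 0.
    apply: (mulfI (expf_neq0 m.-1 z0)); rewrite mulr0 -drE.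
    by apply: (mulfI z1); rewrite mulr0 -[RHS]e2 r0 add0r.
  move/eqP; rewrite subr_eq0 => /eqP h.
  by rewrite rmorphM fmorphV rmorphM !rmorph_nat -h mulrC mulKf ?pnatr_eq0.
have x0 : 0 < (2%:R * m%:R) / (m.+1)%:R :> R.
  by rewrite divr_gt0 ?mulr_gt0 ?ltr0n //; lia.
have := real_root_simple (w := w) _ x0; rewrite -zE dz eqxx => H.
by have /H/(_ rz) : (0 < w m.-1)%N by rewrite /w; case: ifP.
Qed.

End Separability.

(** * The asymptotics *)

(* Padding N with m zeros absorbs the truncation of its recurrence. *)
Lemma shifted_rec (m : nat) (w N c : nat -> nat)
    (u := fun s => if (s < m)%N then 0%N else N (s - m)%N) :
    (forall j, (0 < j)%N -> c j = if (j <= m)%N then w (m - j)%N else 0%N) ->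
    (forall t, N t.+1 = \sum_(1 <= j < t.+1) c j * N (t - j))%N ->
  forall s, u (s + m.+1)%N = (\sum_(j < m) w j * u (s + j))%N.
Proof.
move=> cE Nrec s; rewrite /u ltnNge (_ : m <= s + m.+1)%N /=; last by lia.
rewrite (_ : s + m.+1 - m = s.+1)%N; last by lia.
rewrite Nrec -(big_mkord predT (fun j => w j * u (s + j))%N) [RHS]big_nat_rev /= add0n.
rewrite [RHS](_ : _ = \sum_(1 <= i < m.+1) w (m - i) * u (s + (m - i)))%N; last first.
  by rewrite [RHS]big_add1.
rewrite (big_nat_widen _ _ (s + m).+1) /=; last by lia.
rewrite [RHS](big_nat_widen _ _ (s + m).+1) /=; last by lia.
rewrite big_mkcond [RHS]big_mkcond /= big_nat [RHS]big_nat.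
apply: eq_bigr => j /andP[j0 jsm]; rewrite cE // !ltnS /u.
case: (leqP j s) => js; case: (leqP j m) => jm //=.
- rewrite ltnNge (_ : m <= s + (m - j))%N /=; last by lia.
  by congr (_ * N _)%N; lia.
- by rewrite (_ : s + (m - j) < m)%N ?muln0 //; lia.
Qed.

Section FiniteOrder.
Variables (R : realType) (k m : nat) (w : nat -> nat) (p : {poly R}).
Hypothesis k1 : (1 < k)%N.
Hypothesis m2 : (2 <= m)%N.
Hypothesis w1 : (0 < w m.-1)%N.
Hypothesis w2 : (0 < w m.-2)%N.
Hypothesis simple_roots : forall z : R[i],
  root (rec_poly m w _) z -> (rec_poly m w _)^`().[z] != 0.
Hypothesis pE : p = rec_poly m w R.
Hypothesis wE : forall j, (0 < j)%N ->
  (in_E k j%:Z + in_E k (- j%:Z) = if (j <= m)%N then w (m - j) else 0)%N.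

Lemma finite_order_growth : exists alpha c : R,
  [/\ unique_pos_root p alpha,
      root_coefficient m p (fun t => card_set (N_set k (2 * t)%N)) alpha c,
      0 < c,
      growth_limit (fun t => card_set (reciprocal_set (Some k) (2 * t)%N)) alpha (c / 2)
    & growth_limit (fun t => card_set (primitive_reciprocal_set (Some k) (2 * t)%N))
        alpha (c / 2)].
Proof.
pose A := Zp_exponents k1; pose N := num_words (normal_exp A).
pose u s := if (s < m)%N then 0%N else N (s - m)%N.
have u_small s : (s < m)%N -> u s = 0%N by rewrite /u => ->.
have u_m : u m = 1%N by rewrite /u ltnn subnn.
have u_rec := shifted_rec (N := N) wE _.
have {}u_rec s : u (s + m.+1)%N = (\sum_(j < m) w j * u (s + j))%N.
  apply: u_rec => t; rewrite /N (num_wordsS (normal_exp0 A)).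
  by apply: eq_bigr => j _; rewrite !normal_exp_Zp.
have uN t : u (t + m)%N = N t by rewrite /u ltnNge leq_addl /= addnK.
have [alpha [c [a1 ua [lam [coef [lam_inj rlam lam0 coef0 cN]]] c0 [Nle Nlim]]]] :=
  hecke_growth m2 w1 w2 simple_roots u_small u_m u_rec.
have Nle' j : (N j)%:R <= alpha ^+ j by rewrite -uN.
have Nlim' : growth_limit N alpha c.
  by move: Nlim; rewrite /growth_limit; under boolp.eq_fun do rewrite uN.
exists alpha, c; rewrite pE; split=> //.
- exists lam, coef; split=> // t t2; rewrite -cN // uN card_N_set //; lia.
- apply: growth_limit_half a1 Nle' Nlim' _ => t t0.
  by have [] := reciprocal_count A t0; rewrite -/N; lia.
- apply: growth_limit_half a1 Nle' Nlim' _ => t t0.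
  by have [] := reciprocal_count A t0; rewrite -/N; lia.
Qed.

End FiniteOrder.

(** Subtracting consecutive recurrences leaves N(n+2) = N(n+1) + 2 N(n), with characteristic roots 2
    and -1 and initial values 1, 0. The coefficient 1/3 of 2^t is halved to 1/6 in the limit. *)
Lemma num_words_int t : let N := num_words (normal_exp int_exponents) in
  (3 * (N t)%:Z = 2 ^+ t + 2 * (- 1) ^+ t)%R.
Proof.
move=> N; have N0 := normal_exp0 int_exponents.
have NS n : N n.+1 = (\sum_(1 <= j < n.+1) 2 * N (n - j))%N.
  rewrite /N (num_wordsS N0) big_nat [RHS]big_nat; apply: eq_bigr => j /andP[j0 _].
  by rewrite !normal_exp_int oppr_eq0; case: j j0.
have NSS n : N n.+2 = (N n.+1 + 2 * N n)%N.
  rewrite NS big_ltn // subSS subn0 addnC; congr (_ + _)%N.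
  by rewrite big_add1 /= NS; apply: eq_bigr => j _; rewrite subSS.
have [] : (3 * (N t)%:Z = 2 ^+ t + 2 * (- 1) ^+ t)%R /\
          (3 * (N t.+1)%:Z = 2 ^+ t.+1 + 2 * (- 1) ^+ t.+1)%R => //.
elim: t => [|t [IH1 IH2]]; first by split=> //; rewrite NS big_geq.
split=> //; rewrite NSS PoszD PoszM mulrDr IH2 mulrCA IH1 !exprS; ring.
Qed.

Lemma infinite_order_growth (R : realType) :
  growth_limit (fun t => card_set (reciprocal_set None (2 * t)%N)) (2 : R) (1 / 6) /\
  growth_limit (fun t => card_set (primitive_reciprocal_set None (2 * t)%N)) (2 : R) (1 / 6).
Proof.
pose N := num_words (normal_exp int_exponents).
have NE t : (N t)%:R = (2 ^+ t + 2 * (- 1) ^+ t) / 3 :> R.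
  have /(congr1 (fun z => z%:~R : R)) := num_words_int t.
  rewrite rmorphD !rmorphM !rmorphXn /= rmorphN1 -pmulrn -/N => e.
  by rewrite -e mulrC mulKf // pnatr_eq0.
have Nle t : (N t)%:R <= 2 ^+ t :> R.
  rewrite NE ler_pdivrMr // ; have : 1 <= 2 ^+ t :> R by rewrite exprn_ege1 // ler1n.
  by rewrite -signr_odd; case: (odd t); rewrite ?expr1 ?expr0; lra.
have Nlim : growth_limit N (2 : R) (1 / 3).
  rewrite /growth_limit.
  have -> : (fun t => (N t)%:R / 2 ^+ t) = (fun t => 1 / 3 + (2 / 3) * (- (2^-1)) ^+ t) :> (nat -> R).
    apply: boolp.funext => t; rewrite NE -[- 2^-1]mulN1r exprMn exprVn.
    by field; rewrite expf_neq0.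
  rewrite -[X in _ --> X]addr0; apply: cvgD; first exact: cvg_cst.
  rewrite -[X in _ --> X](mulr0 (2 / 3)); apply: cvgMr; apply: cvg_expr.
  by rewrite normrN ger0_norm ?invr_ge0 // invf_lt1 ?ltr1n.
have two : 1 < 2 :> R by rewrite ltr1n.
have -> : 1 / 6 = 1 / 3 / 2 :> R by field.
split; apply: growth_limit_half two Nle Nlim _ => t t0;
  by have [] := reciprocal_count int_exponents t0; rewrite -/N; lia.
Qed.

Theorem theoremA (R : realType) :
  [/\ (* k = 2m+1 *)
      forall m : nat, (2 <= m)%N -> exists alpha c : R,
        let k := (2 * m + 1)%N in
        let p := hecke_poly_odd R m in
        [/\ unique_pos_root p alpha,
            root_coefficient m p (fun t => card_set (N_set k (2 * t)%N)) alpha c,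
            0 < c,
            growth_limit
              (fun t => card_set (reciprocal_set (Some k) (2 * t)%N)) alpha (c / 2)
          & growth_limit
              (fun t => card_set (primitive_reciprocal_set (Some k) (2 * t)%N))
              alpha (c / 2)],
      (* k = 2m *)
      forall m : nat, (2 <= m)%N -> exists beta d : R,
        let k := (2 * m)%N in
        let p := hecke_poly_even R m in
        [/\ unique_pos_root p beta,
            root_coefficient m p (fun t => card_set (N_set k (2 * t)%N)) beta d,
            0 < d,
            growth_limit
              (fun t => card_set (reciprocal_set (Some k) (2 * t)%N)) beta (d / 2)
          & growth_limit
              (fun t => card_set (primitive_reciprocal_set (Some k) (2 * t)%N))
              beta (d / 2)]
    & (* k infinite *)
      growth_limit (fun t => card_set (reciprocal_set None (2 * t)%N))
        (2 : R) (1 / 6)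
      /\ growth_limit (fun t => card_set (primitive_reciprocal_set None (2 * t)%N))
        (2 : R) (1 / 6)].
Proof.
split=> [m m2|m m2|]; last exact: infinite_order_growth.
- apply: (finite_order_growth (w := fun=> 2%N)) => //; first by lia.
  + exact: odd_simple_roots.
  + by rewrite /hecke_poly_odd /rec_poly big_mkord.
  + by move=> j j0; rewrite /in_E; case: leqP => jm; lia.
(* For k = 2m the absolute value m occurs only once in E_k, because b^m = b^-m; this turns the
   constant coefficient 2 of the odd case into 1. *)
- apply: (finite_order_growth (w := fun j => if j == 0%N then 1%N else 2%N)) => //.
  + by lia.
  + by case: ifP.
  + by case: ifP.
  + exact: even_simple_roots.
  + rewrite /hecke_poly_even /rec_poly -(big_mkord predT (fun j => (if j == 0%N then 1%N else 2%N)%:R *: 'X^j)).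
    rewrite [in RHS]big_ltn /=; last by lia.
    rewrite scale1r expr0 [in RHS]opprD
      [- 1 - _]addrC addrA; congr (_ - _ - _).
    by rewrite !big_nat; apply: eq_bigr => -[|j].
  + by move=> j j0; rewrite /in_E; case: (leqP j m) => jm; [case: ((m - j)%N =P 0%N)|]; lia.
Qed.
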